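(* Let $\Lambda$ be a finite, strongly connected $k$-graph with adjacency matrices $A_1,\dots,A_k$, and suppose that $A=A_1\cdots A_k$ is irreducible. Let $\delta\in(0,1)$ be such that $w_\delta$ is a weight on $\mathcal B_\Lambda$ satisfying $w_\delta(\lambda)=\operatorname{diam}[\lambda]$ for all $\lambda\in F\mathcal B_\Lambda$. Then the eigenspaces $E_{-1}$, $E_0$, $E_\gamma$ ($\gamma\in F\mathcal B_\Lambda$) of the associated Laplace–Beltrami operators $\Delta_s$ refine the wavelet decomposition $L^2(\Lambda^\infty,M)=\mathscr V_0\oplus\bigoplus_{n\in\mathbb N}\mathcal W_n$: namely, $$\mathscr V_0=E_{-1}\oplus E_0\quad\text{and, for every }n\in\mathbb N,\quad \mathcal W_n=\operatorname{span}\{E_\gamma:\gamma\in F\mathcal B_\Lambda,\ |\gamma|=nk+t,\ 0\le t\le k-1\}.$$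
   Context: $\mathbb N=\{0,1,2,\dots\}$. A $k$-graph ($k\ge 1$) is a countable small category $\Lambda$ with a functor $d:\Lambda\to\mathbb N^k$ ($\mathbb N^k$ viewed as a one-object category under addition) such that whenever $d(\lambda)=m+n$ there are unique $\mu,\nu\in\Lambda$ with $d(\mu)=m$, $d(\nu)=n$, $\lambda=\mu\nu$. Here $\lambda\in\Lambda$ means $\lambda$ is a morphism; $\Lambda^n=d^{-1}(n)$; $\Lambda^0$ is identified with the objects (vertices); $r,s:\Lambda\to\Lambda^0$ are range and source. $\Lambda$ is finite if every $\Lambda^n$ is finite, and strongly connected if for all $v,w\in\Lambda^0$ there is $\lambda\in\Lambda$ with $r(\lambda)=v$, $s(\lambda)=w$. With $e_i$ the standard basis of $\mathbb N^k$, the adjacency matrices are $A_i(v,w)=\#\{\lambda\in\Lambda^{e_i}: r(\lambda)=v,\ s(\lambda)=w\}$; $\rho_i$ is the spectral radius of $A_i$. For $\Lambda$ finite and strongly connected, $x^\Lambda\in(0,\infty)^{\Lambda^0}$ is the unique positive vector with $\sum_v x^\Lambda_v=1$ and $A_ix^\Lambda=\rho_ix^\Lambda$ for $1\le i\le k$. Infinite paths: $\Omega_k$ is the $k$-graph with objects $\mathbb N^k$, morphisms $\{(m,n):m\le n\}$, $r(m,n)=m$, $s(m,n)=n$, $d(m,n)=n-m$; $\Lambda^\infty$ is the set of degree-preserving functors $x:\Omega_k\to\Lambda$, with topology generated by the sets $[\lambda]=\{x:x(0,d(\lambda))=\lambda\}$, $\lambda\in\Lambda$. The stationary $k$-Bratteli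 diagram $\mathcal B_\Lambda$ has vertex set $\bigsqcup_{n\ge0}\mathcal V_n$, each $\mathcal V_n$ a copy of $\Lambda^0$, and edge set $\bigsqcup_{n\ge1}\mathcal E_n$, where for $n\equiv i \pmod k$, $1\le i\le k$, the edges in $\mathcal E_n$ from source $q\in\mathcal V_n$ to range $p\in\mathcal V_{n-1}$ are the $A_i(p,q)$ elements of $\Lambda^{e_i}$ with range $p$ and source $q$. $F\mathcal B_\Lambda$ is the set of finite paths $\eta=\eta_1\cdots\eta_m$ ($\eta_i\in\mathcal E_i$, $s(\eta_i)=r(\eta_{i+1})$), of length $|\eta|=m$; vertices in $\mathcal V_0$ are the paths of length $0$. $X_{\mathcal B_\Lambda}$ is the set of infinite paths $(x_n)_{n\ge1}$, $x_n\in\mathcal E_n$, $s(x_n)=r(x_{n+1})$, with the topology generated by cylinder sets $[\lambda]$, $\lambda\in F\mathcal B_\Lambda$ (infinite paths with initial segment $\lambda$). Composing edges identifies a path in $F\mathcal B_\Lambda$ of length $qk+t$ ($0\le t\le k-1$) with a morphism of degree $(q+1,\dots,q+1,q,\dots,q)$ ($t$ entries equal to $q+1$), and identifies $X_{\mathcal B_\Lambda}$ homeomorphically with $\Lambda^\infty$, compatibly with cylinder sets. $M$ is the Borel probability measure on $\Lambda^\infty\cong X_{\mathcal B_\Lambda}$ determined by $M([\lambda])=\rho_1^{-d(\lambda)_1}\cdots\rho_k^{-d(\lambda)_k}x^\Lambda_{s(\lambda)}$, $\lambda\in\Lambda$. A weight is a function $w:F\mathcal B_\Lambda\to(0,\infty)$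 with $\sum_{v\in\mathcal V_0}w(v)\le1$, $\lim_{n}\sup\{w(\lambda):|\lambda|=n\}=0$, and $w(\lambda)<w(\eta)$ whenever $\eta$ is a proper initial segment of $\lambda$. For $|\eta|=qk+t$ with $0\le t\le k-1$, $w_\delta(\eta)=(\rho_1^{q+1}\cdots\rho_t^{q+1}\rho_{t+1}^q\cdots\rho_k^q)^{-1/\delta}x^\Lambda_{s(\eta)}$. For $x\ne y$, $x\wedge y$ is the longest common initial segment ($\emptyset$ if $r(x)\ne r(y)$); $d_\delta(x,y)=w_\delta(x\wedge y)$ if $x\wedge y\neq\emptyset$, $1$ if $x\wedge y=\emptyset$, $d_\delta(x,x)=0$; $\operatorname{diam}[\lambda]=\sup\{d_\delta(x,y):x,y\in[\lambda]\}$. Laplace–Beltrami operators: a choice function is $\tau=(\tau_+,\tau_-):F\mathcal B_\Lambda\to X_{\mathcal B_\Lambda}^2$ with $\tau(\gamma)\in[\gamma]\times[\gamma]$ and $d_\delta(\tau_+(\gamma),\tau_-(\gamma))=\operatorname{diam}[\gamma]$; $\Upsilon_\Lambda$ is the set of choice functions. On $\ell^2(F\mathcal B_\Lambda,\mathbb C^2)$, $\pi_\tau(f)=\bigoplus_\gamma\mathrm{diag}(f(\tau_+(\gamma)),f(\tau_-(\gamma)))$ and $D=\bigoplus_\gamma\frac1{\operatorname{diam}[\gamma]}\begin{pmatrix}0&1\\1&0\end{pmatrix}$. For $\gamma\in F\mathcal B_\Lambda$ let $\mathrm{ext}_1(\gamma)$ be the set of pairs $(e,e')$ of distinct edges of $\mathcal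 B_\Lambda$ with $r(e)=r(e')=s(\gamma)$. $\Upsilon_\Lambda$ is identified with $\prod_\gamma Y_\gamma$, $Y_\gamma=\bigsqcup_{(e,e')\in\mathrm{ext}_1(\gamma)}[\gamma e]\times[\gamma e']$, and carries the product probability measure $N=\prod_\gamma N_\gamma$, where $N_\gamma$ is $M\times M$ restricted to $Y_\gamma$ and normalized. For $s\in\mathbb R$, $\Delta_s$ is the operator on $L^2(X_{\mathcal B_\Lambda},M)$ (densely defined on the span of characteristic functions of cylinder sets) with $\langle f,\Delta_s g\rangle=Q_s(f,g)=\frac12\int_{\Upsilon_\Lambda}\operatorname{Tr}(|D|^{-s}[D,\pi_\tau(f)]^*[D,\pi_\tau(g)])\,dN(\tau)$. Its eigenspaces (independent of $s$; description adapted from Julien–Savinien) are $$E_{-1}=\operatorname{span}\{\chi_{X_{\mathcal B_\Lambda}}\},\qquad E_0=\operatorname{span}\Big\{\tfrac{1}{M([v])}\chi_{[v]}-\tfrac1{M([v'])}\chi_{[v']}:v\ne v'\in\mathcal V_0\Big\},$$ $$E_\gamma=\operatorname{span}\Big\{\tfrac1{M([\gamma e])}\chi_{[\gamma e]}-\tfrac1{M([\gamma e'])}\chi_{[\gamma e']}:(e,e')\in\mathrm{ext}_1(\gamma)\Big\}\quad(\gamma\in F\mathcal B_\Lambda,\text{ including }|\gamma|=0).$$ Wavelet spaces: for $n\in\mathbb N$, $\mathscr V_n=\operatorname{span}\{\chi_{[\lambda]}:\lambda\in\Lambda,\ d(\lambda)=(n,\dots,n)\}\subseteq L^2(\Lambda^\infty,M)$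 and $\mathcal W_n=\mathscr V_{n+1}\cap\mathscr V_n^\perp$. *)

(* Defs.v *)
From HB Require Import structures.
From mathcomp Require Import all_boot all_order all_algebra finmap.
From mathcomp Require Import all_classical all_reals all_analysis.
From mathcomp Require Import complex.

Set Implicit Arguments.
Unset Strict Implicit.
Unset Printing Implicit Defensive.

Import Order.TTheory GRing.Theory Num.Theory.
Import numFieldNormedType.Exports.

Local Open Scope classical_set_scope.
Local Open Scope ring_scope.

Notation multideg k := {ffun 'I_k -> nat}.

(* The [j]-th standard basis vector, for [j < k] counted from 0 (it is 0 for
   [k <= j]). *)
Definition ebasis (k j : nat) : multideg k :=
  [ffun i : 'I_k => nat_of_bool (nat_of_ord i == j)].

Definition md_le k (m n : multideg k) : bool := [forall i, (m i <= n i)%N].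

(* Composition is a total function, of which only the values on composable
   pairs ([src f = rng g], composite [f g]) are meaningful. *)
Record kgraph (k : nat) := KGraph {
  obj : countType;
  mor : countType;
  rng : mor -> obj;
  src : mor -> obj;
  idm : obj -> mor;
  comp : mor -> mor -> mor;
  deg : mor -> multideg k;
  rng_id : forall v, rng (idm v) = v;
  src_id : forall v, src (idm v) = v;
  rng_comp : forall f g, src f = rng g -> rng (comp f g) = rng f;
  src_comp : forall f g, src f = rng g -> src (comp f g) = src g;
  comp_idl : forall f, comp (idm (rng f)) f = f;
  comp_idr : forall f, comp f (idm (src f)) = f;
  comp_assoc : forall f g h, src f = rng g -> src g = rng h ->
    comp f (comp g h) = comp (comp f g) h;
  deg_id : forall v, deg (idm v) = 0;
  deg_comp : forall f g, src f = rng g -> deg (comp f g) = deg f + deg g;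
  factorization : forall l (m n : multideg k), deg l = m + n ->
    exists! p : mor * mor,
      [/\ deg p.1 = m, deg p.2 = n, src p.1 = rng p.2 & l = comp p.1 p.2]
}.

Arguments rng {k L} l : rename.
Arguments src {k L} l : rename.
Arguments idm {k L} v : rename.
Arguments comp {k L} f g : rename.
Arguments deg {k L} l : rename.

Definition kg_finite k (L : kgraph k) : Prop :=
  forall n : multideg k, finite_set [set l : mor L | deg l = n].

Definition strongly_connected k (L : kgraph k) : Prop :=
  forall v w : obj L, exists l : mor L, rng l = v /\ src l = w.

Record kfunctor k (G H : kgraph k) := KFunctor {
  fobj : obj G -> obj H;
  fmor : mor G -> mor H;
  fmor_rng : forall l, rng (fmor l) = fobj (rng l);
  fmor_src : forall l, src (fmor l) = fobj (src l);
  fmor_id : forall v, fmor (idm v) = idm (fobj v);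
  fmor_comp : forall l m, src l = rng m ->
    fmor (comp l m) = comp (fmor l) (fmor m);
  fmor_deg : forall l, deg (fmor l) = deg l
}.

Section Omega.
Variable k : nat.

Lemma md_le_refl (m : multideg k) : md_le m m.
Proof. by apply/forallP => i. Qed.

Lemma md_le_trans (m n p : multideg k) : md_le m n -> md_le n p -> md_le m p.
Proof.
move=> /forallP mn /forallP np; apply/forallP => i.
exact: leq_trans (mn i) (np i).
Qed.

Definition omega_mor := {p : multideg k * multideg k | md_le p.1 p.2}.
HB.instance Definition _ := Countable.on omega_mor.

Definition omega_arrow (m n : multideg k) (mn : md_le m n) : omega_mor :=
  exist (fun p : multideg k * multideg k => md_le p.1 p.2) (m, n) mn.

Definition omega_rng (f : omega_mor) : multideg k := (val f).1.
Definition omega_src (f : omega_mor) : multideg k := (val f).2.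
Definition omega_id (m : multideg k) := omega_arrow (md_le_refl m).
Definition omega_comp (f g : omega_mor) : omega_mor :=
  insubd f (omega_rng f, omega_src g).
Definition omega_deg (f : omega_mor) : multideg k :=
  [ffun i => (omega_src f i - omega_rng f i)%N].

Lemma val_omega_comp f g : omega_src f = omega_rng g ->
  val (omega_comp f g) = (omega_rng f, omega_src g).
Proof.
move=> fg; rewrite /omega_comp insubdK // unfold_in /=.
by apply: (md_le_trans (valP f)); rewrite -/(omega_src f) fg; exact: (valP g).
Qed.

Lemma omega_rng_comp f g : omega_src f = omega_rng g ->
  omega_rng (omega_comp f g) = omega_rng f.
Proof. by move=> fg; rewrite /omega_rng val_omega_comp. Qed.

Lemma omega_src_comp f g : omega_src f = omega_rng g ->
  omega_src (omega_comp f g) = omega_src g.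
Proof. by move=> fg; rewrite /omega_src val_omega_comp. Qed.

Lemma omega_eq (f g : omega_mor) : omega_rng f = omega_rng g ->
  omega_src f = omega_src g -> f = g.
Proof.
rewrite /omega_rng /omega_src => fg1 fg2; apply: val_inj.
by rewrite [LHS]surjective_pairing fg1 fg2 -surjective_pairing.
Qed.

Lemma omega_comp_idl f : omega_comp (omega_id (omega_rng f)) f = f.
Proof. by apply: omega_eq; rewrite ?omega_rng_comp ?omega_src_comp. Qed.

Lemma omega_comp_idr f : omega_comp f (omega_id (omega_src f)) = f.
Proof. by apply: omega_eq; rewrite ?omega_rng_comp ?omega_src_comp. Qed.

Lemma omega_comp_assoc f g h : omega_src f = omega_rng g ->
  omega_src g = omega_rng h ->
  omega_comp f (omega_comp g h) = omega_comp (omega_comp f g) h.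
Proof.
move=> fg gh; apply: omega_eq;
by rewrite ?(omega_rng_comp, omega_src_comp) ?(omega_rng_comp, omega_src_comp).
Qed.

Lemma omega_deg_id m : omega_deg (omega_id m) = 0.
Proof. by apply/ffunP => i; rewrite !ffunE subnn. Qed.

Lemma omega_deg_comp f g : omega_src f = omega_rng g ->
  omega_deg (omega_comp f g) = omega_deg f + omega_deg g.
Proof.
move=> fg; apply/ffunP => i; rewrite !ffunE omega_rng_comp // omega_src_comp //.
have /forallP/(_ i) := valP f; have /forallP/(_ i) := valP g.
rewrite -/(omega_rng f) -/(omega_src f) -/(omega_rng g) -/(omega_src g) fg.
by move=> gi fi; rewrite [RHS]addnC addnBA // subnK.
Qed.

Lemma omega_factorization (l : omega_mor) (m n : multideg k) :
  omega_deg l = m + n ->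
  exists! p : omega_mor * omega_mor,
    [/\ omega_deg p.1 = m, omega_deg p.2 = n, omega_src p.1 = omega_rng p.2 &
        l = omega_comp p.1 p.2].
Proof.
move=> /ffunP lmn.
have le_l i : (omega_rng l i <= omega_src l i)%N by have /forallP := valP l.
have src_l i : omega_src l i = (omega_rng l i + m i + n i)%N.
  by have := lmn i; rewrite !ffunE => e; rewrite -addnA -[RHS]/(_ + (m i + n i))%N
    -[(m i + n i)%N]e subnKC.
have le1 : md_le (omega_rng l) (omega_rng l + m).
  by apply/forallP => i; rewrite ffunE; exact: leq_addr.
have le2 : md_le (omega_rng l + m) (omega_src l).
  by apply/forallP => i; rewrite ffunE src_l; exact: leq_addr.
exists (omega_arrow le1, omega_arrow le2); split.
  split => //=.
  - by apply/ffunP => i; rewrite !ffunE /=; exact: addKn.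
  - by apply/ffunP => i; rewrite !ffunE /= src_l; exact: addKn.
  - by apply: omega_eq; rewrite ?omega_rng_comp ?omega_src_comp.
move=> [p q] [/= /ffunP pm /ffunP qn pq lpq].
have rl : omega_rng l = omega_rng p by rewrite lpq omega_rng_comp.
have sl : omega_src l = omega_src q by rewrite lpq omega_src_comp.
have sp : omega_src p = omega_rng l + m.
  apply/ffunP => i; have := pm i; rewrite !ffunE rl => <-.
  by rewrite [RHS]subnKC //; have /forallP := valP p.
by congr (_, _); apply: omega_eq => //=; rewrite -?pq.
Qed.

Definition Omega : kgraph k :=
  @KGraph k (multideg k : countType) (omega_mor : countType)
    omega_rng omega_src omega_id omega_comp omega_deg
    (fun=> erefl) (fun=> erefl) omega_rng_comp omega_src_comp
    omega_comp_idl omega_comp_idr omega_comp_assoc omega_deg_id omega_deg_comp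
    omega_factorization.

Lemma md_le0 (n : multideg k) : md_le 0 n.
Proof. by apply/forallP => i; rewrite ffunE. Qed.

End Omega.

Section InfinitePaths.
Variables (k : nat) (L : kgraph k).

Definition infpath := kfunctor (Omega k) L.

(* [ip_mor x mn] is the morphism x(m, n). *)
Definition ip_mor (x : infpath) (m n : multideg k) (mn : md_le m n) : mor L :=
  @fmor k (Omega k) L x (omega_arrow mn).

Definition cyl (l : mor L) : set infpath :=
  [set x | ip_mor x (md_le0 (deg l)) = l].

HB.instance Definition _ := gen_eqMixin infpath.
HB.instance Definition _ := gen_choiceMixin infpath.
HB.instance Definition _ :=
  @isSubBaseTopological.Build infpath (set infpath) (range cyl) id.

(* The library requires measurable types to be pointed, whence the base point
   [x0]; neither the sigma-algebra nor anything below depends on it. *)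
Definition ptinfpath (x0 : infpath) := infpath.
HB.instance Definition _ (x0 : infpath) := Choice.on (ptinfpath x0).
HB.instance Definition _ (x0 : infpath) := isPointed.Build (ptinfpath x0) x0.

Definition borel_infpath (x0 : infpath) :=
  @g_sigma_algebraType (ptinfpath x0) (@open infpath).
HB.instance Definition _ (x0 : infpath) := Measurable.on (borel_infpath x0).

End InfinitePaths.

Section Matrices.
Variables (k : nat) (L : kgraph k) (R : realType).

(* The enumeration [vert] exhausts the vertices as soon as they are finitely
   many. *)
Definition nvert : nat := #|` fset_set [set: obj L]|.
Definition vert (a : 'I_nvert) : obj L :=
  tnth (in_tuple (fset_set [set: obj L])) a.

Definition adjacency (i : 'I_k) : 'M[R]_nvert :=
  \matrix_(a, b) (#|` fset_set [set l : mor L |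
    [/\ deg l = ebasis k i, rng l = vert a & src l = vert b]]|)%:R.

Definition spectral_radius n (A : 'M[R]_n) : R :=
  sup [set complex.Re `|z| | z in
    [set z : R[i] | eigenvalue (map_mx (real_complex R) A) z]].

Definition irreducible_mx n (A : 'M[R]_n) : Prop :=
  forall a b, exists m : nat, (0 < m)%N /\ 0 < (A ^+ m) a b.

Definition rho (i : 'I_k) : R := spectral_radius (adjacency i).

Definition is_perron_vector (x : obj L -> R) : Prop :=
  [/\ forall v, 0 < x v,
      \sum_(v \in [set: obj L]) x v = 1 &
      forall i : 'I_k, adjacency i *m (\col_a x (vert a)) =
                       rho i *: (\col_a x (vert a))].

End Matrices.

Section Bratteli.
Variables (k : nat) (L : kgraph k).

(* Edge levels are counted from 0: index [n] stands for level [n + 1], whose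
   edges are the morphisms of degree e_((n mod k) + 1), colours being counted
   from 1. *)
Definition bdegree (n : nat) : multideg k := ebasis k (n %% k).

Fixpoint is_bpath (n : nat) (v : obj L) (p : seq (mor L)) : bool :=
  if p is e :: p' then
    [&& rng e == v, deg e == bdegree n & is_bpath n.+1 (src e) p']
  else true.

Record bpath := BPath {
  bp_rng : obj L;
  bp_edges : seq (mor L);
  bpathP : is_bpath 0 bp_rng bp_edges
}.

Definition bp_len (g : bpath) : nat := size (bp_edges g).
Definition bp_src (g : bpath) : obj L :=
  last (bp_rng g) (map src (bp_edges g)).
Definition bp_vertex (v : obj L) : bpath := @BPath v [::] isT.

Definition bp_proper_prefix (g h : bpath) : Prop :=
  [/\ bp_rng g = bp_rng h, prefix (bp_edges g) (bp_edges h) &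
      (bp_len g < bp_len h)%N].

Record xpath := XPath {
  xedge : nat -> mor L;
  xedge_deg : forall n, deg (xedge n) = bdegree n;
  xedge_comp : forall n, src (xedge n) = rng (xedge n.+1)
}.

Definition xrng (x : xpath) : obj L := rng (xedge x 0).

(* Infinite paths whose initial segment is the path with range [v] and list of
   edges [p]. *)
Definition bcyl (v : obj L) (p : seq (mor L)) : set xpath :=
  [set x | xrng x = v /\ mkseq (xedge x) (size p) = p].

Lemma is_bpath_xedge (x : xpath) (n m : nat) :
  is_bpath m (rng (xedge x m)) (map (xedge x) (iota m n)).
Proof.
elim: n m => [//|n IH] m /=.
by rewrite eqxx xedge_deg eqxx /= xedge_comp; exact: IH.
Qed.

Definition xprefix (x : xpath) (n : nat) : bpath :=
  @BPath (xrng x) (mkseq (xedge x) n) (is_bpath_xedge x n 0).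

(* [None] encodes the empty meet (also returned, meaninglessly, if [x = y]). *)
Definition xmeet (x y : xpath) : option bpath :=
  if xrng x == xrng y then
    match pselect (exists n, xedge x n != xedge y n) with
    | left xy => Some (xprefix x (ex_minn xy))
    | right _ => None
    end
  else None.

(* The degree of the composite of the first [n] edges of a path. *)
Definition bsumdeg (n : nat) : multideg k :=
  [ffun i : 'I_k => (n %/ k + (i < n %% k))%N].

Lemma bsumdegS n : bsumdeg n.+1 = bsumdeg n + bdegree n.
Proof.
apply/ffunP => i; rewrite !ffunE.
have k0 : (0 < k)%N by exact: leq_ltn_trans (ltn_ord i).
rewrite -[RHS]/(n %/ k + (i < n %% k) + (nat_of_ord i == n %% k))%N.
rewrite -addnA.
have -> : ((i < n %% k) + (nat_of_ord i == n %% k) = (i <= n %% k))%N.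
  by case: ltngtP.
have := ltn_pmod n k0; rewrite leq_eqVlt => /predU1P[e|lt].
  have nS : n.+1 = ((n %/ k).+1 * k)%N.
    by rewrite [in LHS](divn_eq n k) -addnS e mulSn addnC.
  rewrite nS mulnK // modnMl ltn0 addn0 -ltnS e ltn_ord.
  by rewrite addn1.
have -> : (n.+1 %/ k = n %/ k)%N.
  by rewrite [in LHS](divn_eq n k) -addnS divnMDl // (divn_small lt) addn0.
have -> : (n.+1 %% k = (n %% k).+1)%N.
  by rewrite [in LHS](divn_eq n k) -addnS modnMDl (modn_small lt).
by [].
Qed.

Lemma bsumdeg_leS n : md_le (bsumdeg n) (bsumdeg n.+1).
Proof.
by apply/forallP => i; rewrite bsumdegS [X in (_ <= X)%N]ffunE; exact: leq_addr.
Qed.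

Definition to_xedge (x : infpath L) (n : nat) : mor L :=
  ip_mor x (bsumdeg_leS n).

Lemma to_xedge_deg x n : deg (to_xedge x n) = bdegree n.
Proof.
rewrite /to_xedge /ip_mor fmor_deg; apply/ffunP => i.
rewrite [LHS]ffunE /omega_src /omega_rng /= bsumdegS [X in (X - _)%N]ffunE.
exact: addKn.
Qed.

Lemma to_xedge_comp x n : src (to_xedge x n) = rng (to_xedge x n.+1).
Proof. by rewrite fmor_src fmor_rng. Qed.

(* The canonical homeomorphism from infinite paths of the k-graph to infinite
   paths of its Bratteli diagram. *)
Definition to_xpath (x : infpath L) : xpath :=
  XPath (to_xedge_deg x) (to_xedge_comp x).

Definition bcyl_inf (v : obj L) (p : seq (mor L)) : set (infpath L) :=
  to_xpath @^-1` bcyl v p.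

End Bratteli.

Section Weights.
Variables (k : nat) (L : kgraph k) (R : realType).

Definition is_weight (w : bpath L -> R) : Prop :=
  [/\ forall g, 0 < w g,
      \sum_(v \in [set: obj L]) w (bp_vertex v) <= 1,
      (fun n : nat => ereal_sup [set (w g)%:E | g in [set g | bp_len g = n]])
        @ \oo --> 0%:E &
      forall g h, bp_proper_prefix g h -> w h < w g].

Definition weight_dist (w : bpath L -> R) (x y : xpath L) : R :=
  if `[< x = y >] then 0 else if xmeet x y is Some g then w g else 1.

Definition cyl_diam (w : bpath L -> R) (g : bpath L) : \bar R :=
  ereal_sup [set (weight_dist w x y)%:E |
    x in bcyl (bp_rng g) (bp_edges g) & y in bcyl (bp_rng g) (bp_edges g)].

Definition w_delta (x : obj L -> R) (delta : R) (g : bpath L) : R :=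
  (\prod_(i < k) rho L R i ^+ (bsumdeg k (bp_len g) i)) `^ (- delta^-1) *
  x (bp_src g).

End Weights.

(* Elements of complex L^2 are represented by functions; the subspaces below
   are closed under almost everywhere equality of square integrable functions,
   so that their equality as sets is equality as subspaces of L^2. *)
Section ComplexL2.
Context d (T : measurableType d) (R : realType) (mu : {measure set T -> \bar R}).
Implicit Types (f g : T -> R[i]) (S A B : set (T -> R[i])).

Definition L2 : set (T -> R[i]) :=
  [set f | (fun x => complex.Re (f x)) \in Lfun mu 2%:E /\
           (fun x => complex.Im (f x)) \in Lfun mu 2%:E].

Definition cintegral f : R[i] :=
  Complex (\int[mu]_x complex.Re (f x)) (\int[mu]_x complex.Im (f x)).

Definition dotL2 f g : R[i] := cintegral (fun x => conjc (f x) * g x).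

Definition normL2 f : R := Num.sqrt (complex.Re (dotL2 f f)).

Definition spanL2 S : set (T -> R[i]) :=
  [set f | L2 f /\
    exists (n : nat) (c : 'I_n -> R[i]) (g : 'I_n -> T -> R[i]),
      (forall i, S (g i)) /\ {ae mu, forall x, f x = \sum_(i < n) c i * g i x}].

Definition orthogonalL2 A B : Prop :=
  forall f g, A f -> B g -> dotL2 f g = 0.

Definition is_orthogonal_sum V A B : Prop :=
  orthogonalL2 A B /\
  V = [set h | exists f g, [/\ A f, B g & h = (fun x => f x + g x)]].

Definition is_hilbert_sum A (W : nat -> set (T -> R[i])) : Prop :=
  [/\ forall n, orthogonalL2 A (W n),
      forall m n, m != n -> orthogonalL2 (W m) (W n),
      A `<=` L2,
      forall n, W n `<=` L2 &
      forall f, L2 f -> forall e : R, 0 < e ->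
        exists g, spanL2 (A `|` \bigcup_n W n) g /\
                  normL2 (fun x => f x - g x) < e].

Definition nchi (C : set T) (x : T) : R[i] :=
  ((fine (mu C))^-1)%:C%C * \1_C x.

End ComplexL2.

Section Spaces.
Variables (k : nat) (L : kgraph k) (R : realType) (x0 : infpath L).
Variable M : probability (borel_infpath x0) R.

Notation T := (borel_infpath x0).

Definition is_graph_measure (x : obj L -> R) : Prop :=
  forall l : mor L,
    M (cyl l) = ((\prod_(i < k) rho L R i ^- deg l i) * x (src l))%:E.

Definition waveletV (n : nat) : set (T -> R[i]) :=
  spanL2 M [set f | exists2 l : mor L,
    deg l = [ffun=> n] & f = \1_(cyl l : set T)].

Definition waveletW (n : nat) : set (T -> R[i]) :=
  [set f | waveletV n.+1 f /\ forall g, waveletV n g -> dotL2 M g f = 0].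

Definition eigen_m1 : set (T -> R[i]) := spanL2 M [set \1_(setT : set T)].

Definition eigen_0 : set (T -> R[i]) :=
  spanL2 M [set f | exists v v' : obj L, v <> v' /\
    f = (fun x => nchi M (bcyl_inf v [::]) x - nchi M (bcyl_inf v' [::]) x)].

Definition ext1 (g : bpath L) : set (mor L * mor L) :=
  [set p | [/\ p.1 <> p.2,
               deg p.1 = bdegree k (bp_len g), deg p.2 = bdegree k (bp_len g),
               rng p.1 = bp_src g & rng p.2 = bp_src g]].

Definition eigen_path (g : bpath L) : set (T -> R[i]) :=
  spanL2 M [set f | exists2 p, ext1 g p &
    f = (fun x => nchi M (bcyl_inf (bp_rng g) (rcons (bp_edges g) p.1)) x -
                  nchi M (bcyl_inf (bp_rng g) (rcons (bp_edges g) p.2)) x)].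

End Spaces.

(* Main.v *)
Require Import Defs.
From HB Require Import structures.
From mathcomp Require Import all_boot all_order all_algebra finmap.
From mathcomp Require Import all_classical all_reals all_analysis.
From mathcomp Require Import measurable_realfun complex ring.

(** A cylinder set is the disjoint union of the cylinders of its one-edge
    extensions, so the characteristic function of an extension is a multiple of
    that of the parent plus a combination of differences of normalised siblings.
    Iterating over the [k] levels between [nk] and [(n+1)k] gives
    [V_(n+1) = V_n + span {E_g : nk <= |g| < (n+1)k}], and these [E_g] are
    orthogonal to [V_n] because a cylinder of diagonal degree [(n,...,n)] either
    contains both siblings or misses both; hence the span is [W_n].  Density of
    the union of the [V_n] is the pi-lambda theorem applied to the diagonal
    cylinders, which are pairwise nested or disjoint and form a basis of the
    topology.  Besides the splitting of cylinders, the only fact needed about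
    the measure is that cylinders have nonzero mass: the cylinders of degree
    [e_i] have total mass 1, which rules out [rho_i = 0]. *)

Set Implicit Arguments.
Unset Strict Implicit.
Unset Printing Implicit Defensive.

Import Order.TTheory GRing.Theory Num.Theory.
Import numFieldNormedType.Exports.

Local Open Scope classical_set_scope.
Local Open Scope ring_scope.

(** * Square integrable complex functions *)

Section ComplexParts.
Variable R : realType.
Implicit Types x y : R[i].

Lemma ReD x y : complex.Re (x + y) = complex.Re x + complex.Re y.
Proof. by case: x; case: y. Qed.

Lemma ImD x y : complex.Im (x + y) = complex.Im x + complex.Im y.
Proof. by case: x; case: y. Qed.

Lemma ReM x y :
  complex.Re (x * y) =
  complex.Re x * complex.Re y - complex.Im x * complex.Im y.
Proof. by case: x; case: y. Qed.

Lemma ImM x y :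
  complex.Im (x * y) =
  complex.Re x * complex.Im y + complex.Im x * complex.Re y.
Proof. by case: x; case: y. Qed.

Lemma ReJ x : complex.Re (conjc x) = complex.Re x.
Proof. by case: x. Qed.

Lemma ImJ x : complex.Im (conjc x) = - complex.Im x.
Proof. by case: x. Qed.

Definition complexpE := (ReD, ImD, ReM, ImM, ReJ, ImJ).

Lemma complexP x y :
  complex.Re x = complex.Re y -> complex.Im x = complex.Im y -> x = y.
Proof. by case: x y => [a b] [c d] /= -> ->. Qed.

End ComplexParts.

Section SquareIntegrable.
Context d (T : measurableType d) (R : realType).
Variable mu : {measure set T -> \bar R}.
Local Notation L2r := (Lfun mu 2%:E).
Implicit Types a b c : T -> R.

Lemma Lfun2D a b : a \in L2r -> b \in L2r -> (fun x => a x + b x) \in L2r.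
Proof. by move=> ha hb; exact: (Lfun_addr_closed mu (lee1n 2)).2. Qed.

Lemma Lfun2Z r a : a \in L2r -> (fun x => r * a x) \in L2r.
Proof.
have -> : (fun x => r * a x) = r \o* a by apply/funext => x /=; rewrite mulrC.
by apply: Lfun_scale; exact: ler1n.
Qed.

Lemma Lfun2_measurable a : a \in L2r -> measurable_fun setT a.
Proof. by rewrite inE => /andP[]; rewrite inE. Qed.

Lemma Lfun2P a : measurable_fun setT a ->
  mu.-integrable setT (EFin \o (fun x => a x ^+ 2)) -> a \in L2r.
Proof.
move=> ma /integrableP[_ ia]; rewrite inE; apply/andP; split; rewrite inE //=.
rewrite /finite_norm unlock poweR_lty//=; apply: le_lt_trans ia.
apply: ge0_le_integral => //.
- apply/measurable_EFinP.
  apply/(@measurableT_comp _ _ _ _ _ _ (fun x : R => x `^ 2)%R) => //.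
  exact: measurableT_comp.
- apply: measurableT_comp => //; apply/measurable_EFinP.
  exact: measurable_funX.
- by move=> x _; rewrite lee_fin /= powR_mulrn// normrX.
Qed.

Definition dotr a b : R := \int[mu]_x (a x * b x).

Lemma dotr_integrable {a b} : a \in L2r -> b \in L2r ->
  mu.-integrable setT (EFin \o (fun x => a x * b x)).
Proof. by move=> ha hb; apply/Lfun1_integrable; exact: Lfun2_mul_Lfun1. Qed.

Lemma dotrC a b : dotr a b = dotr b a.
Proof. by rewrite /dotr; under eq_Rintegral do rewrite mulrC. Qed.

Lemma dotrDr a b c : a \in L2r -> b \in L2r -> c \in L2r ->
  dotr a (fun x => b x + c x) = dotr a b + dotr a c.
Proof.
move=> ha hb hc; rewrite /dotr; under eq_Rintegral do rewrite mulrDr.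
by rewrite RintegralD//; exact: dotr_integrable.
Qed.

Lemma dotrZr r a b : a \in L2r -> b \in L2r ->
  dotr a (fun x => r * b x) = r * dotr a b.
Proof.
move=> ha hb; rewrite /dotr; under eq_Rintegral do rewrite mulrCA.
by rewrite RintegralZl//; exact: dotr_integrable.
Qed.

Lemma dotr_ae a b c : a \in L2r -> b \in L2r -> c \in L2r ->
  {ae mu, forall x, b x = c x} -> dotr a b = dotr a c.
Proof.
move=> ha hb hc bc; rewrite /dotr /Rintegral; congr fine.
apply: ae_eq_integral => //.
- exact: (measurable_int _ (dotr_integrable ha hb)).
- exact: (measurable_int _ (dotr_integrable ha hc)).
- by apply: filterS bc => x + _ => /= ->.
Qed.

Lemma dotr_ge0 a : 0 <= dotr a a.
Proof. by apply: Rintegral_ge0 => x _; rewrite -expr2 sqr_ge0. Qed.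

Lemma dotr_eq0 a : a \in L2r -> dotr a a = 0 -> {ae mu, forall x, a x = 0}.
Proof.
move=> ha a0; have ia := dotr_integrable ha ha.
have : (\int[mu]_x `|(a x * a x)%:E| = 0)%E.
  under eq_integral do rewrite gee0_abs ?lee_fin -?expr2 ?sqr_ge0//.
  have := integrable_fin_num measurableT ia.
  under eq_integral do rewrite /= -expr2.
  move=> /fineK <-; rewrite -[RHS]/(0%:E); congr EFin.
  rewrite -[RHS]a0 /dotr /Rintegral.
  by under [in RHS]eq_integral do rewrite -expr2.
move/(ae_eq_integral_abs mu measurableT (measurable_int _ ia)).1.
by apply: filterS => x /(_ I) [] /eqP; rewrite mulf_eq0 orbb => /eqP.
Qed.

End SquareIntegrable.

Section ComplexSquareIntegrable.
Context d (T : measurableType d) (R : realType).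
Variable mu : {measure set T -> \bar R}.
Implicit Types (f g h : T -> R[i]) (V W S : set (T -> R[i])).
Local Notation re f := (fun x => complex.Re (f x)).
Local Notation im f := (fun x => complex.Im (f x)).
Local Notation L2 := (L2 mu).
Local Notation dot := (dotL2 mu).

Lemma L2_lin c f g : L2 f -> L2 g -> L2 (fun x => c * f x + g x).
Proof.
move=> [f1 f2] [g1 g2]; split.
- under eq_fun do rewrite complexpE complexpE -mulNr.
  by do ![exact: Lfun2Z | apply: Lfun2D].
- under eq_fun do rewrite complexpE complexpE.
  by do ![exact: Lfun2Z | apply: Lfun2D].
Qed.

Lemma L2_0 : L2 (fun=> 0).
Proof. by split; exact: (Lfun_addr_closed mu (lee1n 2)).1. Qed.

Lemma L2D f g : L2 f -> L2 g -> L2 (fun x => f x + g x).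
Proof. by move=> hf /(L2_lin 1 hf); under eq_fun do rewrite mul1r. Qed.

Lemma L2Z c f : L2 f -> L2 (fun x => c * f x).
Proof. by move=> /(L2_lin c)/(_ L2_0); under eq_fun do rewrite addr0. Qed.

Lemma L2B f g : L2 f -> L2 g -> L2 (fun x => f x - g x).
Proof.
move=> hf hg; have := L2_lin (- 1) hg hf.
by under eq_fun do rewrite mulN1r addrC.
Qed.

Lemma dotL2E f g : L2 f -> L2 g ->
  dot f g = Complex (dotr mu (re f) (re g) + dotr mu (im f) (im g))
                    (dotr mu (re f) (im g) - dotr mu (im f) (re g)).
Proof.
move=> [f1 f2] [g1 g2]; rewrite /dotL2 /cintegral; congr Complex.
- under eq_Rintegral do rewrite !complexpE mulNr opprK.
  by rewrite RintegralD//; exact: dotr_integrable.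
- under eq_Rintegral do rewrite !complexpE mulNr.
  by rewrite RintegralB//; exact: dotr_integrable.
Qed.

Lemma dotL2_linr c f g h : L2 f -> L2 g -> L2 h ->
  dot f (fun x => c * g x + h x) = c * dot f g + dot f h.
Proof.
move=> hf hg hh; rewrite (dotL2E hf (L2_lin c hg hh)) !dotL2E//.
have [[[f1 f2] [g1 g2]] [h1 h2]] := (hf, hg, hh).
have reE : re (fun x => c * g x + h x) =
    (fun x => complex.Re c * complex.Re (g x) +
              (- complex.Im c * complex.Im (g x) + complex.Re (h x))).
  by apply/funext => x; rewrite !complexpE; ring.
have imE : im (fun x => c * g x + h x) =
    (fun x => complex.Re c * complex.Im (g x) +
              (complex.Im c * complex.Re (g x) + complex.Im (h x))).
  by apply/funext => x; rewrite !complexpE; ring.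
rewrite reE imE !(dotrDr, dotrZr)//;
  do ?[exact: Lfun2Z | apply: Lfun2D | by []].
by case: c {reE imE} => a b /=; congr Complex; ring.
Qed.

Lemma dotL2C f g : L2 f -> L2 g -> dot g f = conjc (dot f g).
Proof.
move=> hf hg; rewrite !dotL2E//=; congr Complex.
- by rewrite (dotrC _ (re f)) (dotrC _ (im f)).
- by rewrite (dotrC _ (re f)) (dotrC _ (im f)) opprB.
Qed.

Lemma dotL2_ae f g h : L2 f -> L2 g -> L2 h ->
  {ae mu, forall x, g x = h x} -> dot f g = dot f h.
Proof.
move=> hf hg hh gh; rewrite !dotL2E//.
have [[[f1 f2] [g1 g2]] [h1 h2]] := (hf, hg, hh).
have gh1 : {ae mu, forall x, complex.Re (g x) = complex.Re (h x)}.
  by apply: filterS gh => x ->.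
have gh2 : {ae mu, forall x, complex.Im (g x) = complex.Im (h x)}.
  by apply: filterS gh => x ->.
by congr (Complex (_ + _) (_ - _)); exact: dotr_ae.
Qed.

Lemma dotL20 f : L2 f -> dot f (fun=> 0) = 0.
Proof.
move=> hf; have := dotL2_linr (-1) hf L2_0 L2_0.
by under eq_fun do rewrite mulr0 addr0; rewrite mulN1r addNr.
Qed.

Lemma dotL2Zr c f g : L2 f -> L2 g -> dot f (fun x => c * g x) = c * dot f g.
Proof.
move=> hf hg; have := dotL2_linr c hf hg L2_0.
by under eq_fun do rewrite addr0; rewrite dotL20// addr0.
Qed.

Lemma dotL2Br f g h : L2 f -> L2 g -> L2 h ->
  dot f (fun x => g x - h x) = dot f g - dot f h.
Proof.
move=> hf hg hh; have := dotL2_linr (-1) hf hh hg.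
by under eq_fun do rewrite mulN1r addrC; move=> ->; rewrite mulN1r addrC.
Qed.

Lemma dotL2_eq0 f : L2 f -> dot f f = 0 -> {ae mu, forall x, f x = 0}.
Proof.
move=> hf; rewrite dotL2E// => -[/eqP + _].
rewrite paddr_eq0 ?dotr_ge0// => /andP[/eqP r0 /eqP i0].
have [f1 f2] := hf; move/dotr_eq0: r0 => /(_ f1); move/dotr_eq0: i0 => /(_ f2).
by apply: filterS2 => x fi fr; apply: complexP.
Qed.

Definition subspaceL2 V : Prop :=
  [/\ V `<=` L2, V (fun=> 0),
      forall c f g, V f -> V g -> V (fun x => c * f x + g x) &
      forall f g, V f -> L2 g -> {ae mu, forall x, f x = g x} -> V g].

Lemma subspaceL2_scale V c f : subspaceL2 V -> V f -> V (fun x => c * f x).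
Proof.
by move=> [_ V0 VD _] /(VD c)/(_ V0); under eq_fun do rewrite addr0.
Qed.

Lemma subspaceL2_add V f g :
  subspaceL2 V -> V f -> V g -> V (fun x => f x + g x).
Proof.
by move=> [_ _ VD _] hf /(VD 1 _ _ hf); under eq_fun do rewrite mul1r.
Qed.

Lemma subspaceL2_sub V f g :
  subspaceL2 V -> V f -> V g -> V (fun x => f x - g x).
Proof.
move=> [_ _ VD _] hf hg; have := VD (-1) _ _ hg hf.
by under eq_fun do rewrite mulN1r addrC.
Qed.

Lemma subspaceL2_sum V I (s : seq I) (P : pred I) (f : I -> T -> R[i]) :
  subspaceL2 V -> (forall i, P i -> V (f i)) ->
  V (fun x => \sum_(i <- s | P i) f i x).
Proof.
move=> sV Vf; elim: s => [|i s IH].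
  by under eq_fun do rewrite big_nil; case: sV.
under eq_fun do rewrite big_cons.
case Pi: (P i) => //; apply: subspaceL2_add => //; exact: Vf.
Qed.

Lemma subspaceL2_span S : subspaceL2 (spanL2 mu S).
Proof.
split.
- by move=> f [].
- split; first exact: L2_0.
  exists 0%N, (fun=> 0), (fun _ _ => 0); split; first by case.
  by apply: aeW => x; rewrite big_ord0.
- move=> c f g [hf [m [a [p [Sp fE]]]]] [hg [n [b [q [Sq gE]]]]].
  split; first exact: L2_lin.
  exists (m + n)%N,
    (fun i => match fintype.split i with inl j => c * a j | inr j => b j end),
    (fun i => match fintype.split i with inl j => p j | inr j => q j end).
  split.
    by move=> i; case: fintype.split.
  apply: filterS2 fE gE => x -> ->; rewrite big_split_ord/=; congr (_ + _).
    rewrite mulr_sumr; apply: eq_bigr => i _.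
    by rewrite (unsplitK (inl i : 'I_m + 'I_n)) mulrA.
  by apply: eq_bigr => i _; rewrite (unsplitK (inr i : 'I_m + 'I_n)).
- move=> f g [hf [m [a [p [Sp fE]]]]] hg fg; split => //.
  by exists m, a, p; split => //; apply: filterS2 fE fg => x <- <-.
Qed.

Lemma spanL2_gen S : S `<=` L2 -> S `<=` spanL2 mu S.
Proof.
move=> SL f Sf; split; first exact: SL.
exists 1%N, (fun=> 1), (fun=> f); split => //.
by apply: aeW => x; rewrite big_ord1 mul1r.
Qed.

Lemma spanL2_min S V : subspaceL2 V -> S `<=` V -> spanL2 mu S `<=` V.
Proof.
move=> sV SV f [hf [m [a [p [Sp fE]]]]]; have [_ _ _ Vae] := sV.
apply: (Vae (fun x => \sum_(i < m) a i * p i x)) => //; last first.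
  by apply: filterS fE => x ->.
apply: subspaceL2_sum => // i _.
by apply: subspaceL2_scale => //; exact/SV/Sp.
Qed.

Lemma spanL2S S S' : S `<=` S' -> spanL2 mu S `<=` spanL2 mu S'.
Proof.
move=> SS' f [hf [m [a [p [Sp fE]]]]]; split => //.
by exists m, a, p; split => // i; exact: SS'.
Qed.

Lemma subspaceL2_orth S : S `<=` L2 ->
  subspaceL2 [set g | L2 g /\ forall f, S f -> dot f g = 0].
Proof.
move=> SL; split.
- by move=> f [].
- by split=> [|f Sf]; [exact: L2_0 | rewrite dotL20//; exact: SL].
- move=> c f g [hf f0] [hg g0]; split=> [|h Sh]; first exact: L2_lin.
  by rewrite dotL2_linr ?f0 ?g0 ?mulr0 ?addr0//; exact: SL.
- move=> f g [hf f0] hg fg; split=> // h Sh.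
  by rewrite -(f0 _ Sh); apply/esym/dotL2_ae => //; exact: SL.
Qed.

Lemma orthogonal_spanL2 S S' : S `<=` L2 -> S' `<=` L2 ->
  orthogonalL2 mu S S' -> orthogonalL2 mu (spanL2 mu S) (spanL2 mu S').
Proof.
move=> SL SL' o.
have o1 f g : S f -> spanL2 mu S' g -> dot f g = 0.
  move=> Sf /(spanL2_min (subspaceL2_orth SL))[] => [h Sh|_]; last exact.
  by split=> [|p Sp]; [exact: SL' | exact: o].
move=> f g Sf Sg; have [hf hg] := (Sf.1, Sg.1).
have sL' : spanL2 mu S' `<=` L2 by move=> ? [].
rewrite dotL2C//; apply/eqP; rewrite conjc_eq0; apply/eqP.
have [|_] := spanL2_min (subspaceL2_orth sL') _ Sf; last exact.
move=> h Sh; split=> [|p Sp]; first exact: SL.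
by rewrite dotL2C ?(o1 _ _ Sh Sp) ?conjc0//; [exact: SL | exact: sL'].
Qed.

Lemma subspaceL2_plus V W : subspaceL2 V -> subspaceL2 W ->
  subspaceL2 [set h | exists f g, [/\ V f, W g & h = (fun x => f x + g x)]].
Proof.
move=> sV sW; have [VL V0 VD _] := sV; have [WL W0 WD Wae] := sW; split.
- by move=> _ [f [g [/VL hf /WL hg ->]]]; exact: L2D.
- by exists (fun=> 0), (fun=> 0); split=> //; apply/funext => x; rewrite addr0.
- move=> c _ _ [f [g [Vf Wg ->]]] [f' [g' [Vf' Wg' ->]]].
  exists (fun x => c * f x + f' x), (fun x => c * g x + g' x).
  by split; [exact: VD | exact: WD | apply/funext => x; ring].
- move=> _ h' [f [g [Vf Wg ->]]] hh' hE.
  exists f, (fun x => h' x - f x); split=> //; last first.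
    by apply/funext => x; rewrite addrC subrK.
  apply: (Wae g) => //; first by apply: L2B => //; exact: VL.
  by apply: filterS hE => x <-; rewrite addrC addKr.
Qed.

Lemma spanL2U S S' : S `<=` L2 -> S' `<=` L2 ->
  spanL2 mu (S `|` S') = [set h | exists f g,
    [/\ spanL2 mu S f, spanL2 mu S' g & h = (fun x => f x + g x)]].
Proof.
move=> SL SL'; have s0 U : spanL2 mu U (fun=> 0) by case: (subspaceL2_span U).
apply/seteqP; split=> [|_ [f [g [Sf Sg ->]]]].
- apply: spanL2_min; first by apply: subspaceL2_plus; exact: subspaceL2_span.
  move=> f [Sf|Sf].
    exists f, (fun=> 0); split=> //; first exact: spanL2_gen.
    by apply/funext => x; rewrite addr0.
  exists (fun=> 0), f; split=> //; first exact: spanL2_gen.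
  by apply/funext => x; rewrite add0r.
- apply: subspaceL2_add; first exact: subspaceL2_span.
  + by apply: spanL2S Sf; exact: subsetUl.
  + by apply: spanL2S Sg; exact: subsetUr.
Qed.

End ComplexSquareIntegrable.

Section SquareNorm.
Context d (T : measurableType d) (R : realType).
Variable mu : {measure set T -> \bar R}.
Implicit Types (f g h : T -> R[i]) (V : set (T -> R[i])) (a : T -> R).
Local Notation L2 := (L2 mu).
Local Notation dot := (dotL2 mu).

Definition sqnormL2 f : R := complex.Re (dot f f).
Local Notation N2 := sqnormL2.

Lemma sqnormL2E f : L2 f -> N2 f =
  dotr mu (fun x => complex.Re (f x)) (fun x => complex.Re (f x)) +
  dotr mu (fun x => complex.Im (f x)) (fun x => complex.Im (f x)).
Proof. by move=> hf; rewrite /N2 dotL2E. Qed.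

Lemma sqnormL2_ge0 f : L2 f -> 0 <= N2 f.
Proof. by move=> hf; rewrite sqnormL2E// addr_ge0// dotr_ge0. Qed.

Lemma sqnormL2_0 : N2 (fun=> 0) = 0.
Proof. by rewrite /N2 dotL20//; exact: L2_0. Qed.

Lemma sqnormL2_ae f g : L2 f -> L2 g -> {ae mu, forall x, f x = g x} ->
  N2 f = N2 g.
Proof.
move=> hf hg fg; rewrite /N2 (dotL2_ae hf hf hg fg) dotL2C// complexpE.
by rewrite (dotL2_ae hg hf hg fg).
Qed.

Lemma sqnormL2Z c f : L2 f ->
  N2 (fun x => c * f x) = (complex.Re c ^+ 2 + complex.Im c ^+ 2) * N2 f.
Proof.
move=> hf; have hcf := L2Z c hf.
rewrite /N2 dotL2Zr// (dotL2C hf hcf) dotL2Zr//.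
have : complex.Im (dot f f) = 0 by rewrite dotL2E//= dotrC subrr.
by move=> i0; rewrite !complexpE i0; ring.
Qed.

Lemma sqnormL2D f g : L2 f -> L2 g ->
  N2 (fun x => f x + g x) <= 2 * N2 f + 2 * N2 g.
Proof.
move=> hf hg; have hp := L2D hf hg; have hm := L2B hf hg.
have expand c : N2 (fun x => c * f x + g x) =
    (complex.Re c ^+ 2 + complex.Im c ^+ 2) * N2 f + N2 g +
    2 * complex.Re (conjc c * dot f g).
  have hl := L2_lin c hf hg.
  rewrite /N2 dotL2_linr// (dotL2C hf hl) (dotL2C hg hl) !dotL2_linr//.
  rewrite (dotL2C hf hg).
  have : complex.Im (dot f f) = 0 by rewrite dotL2E//= dotrC subrr.
  by move=> i0; rewrite !complexpE i0; ring.
have := sqnormL2_ge0 (L2_lin (-1) hf hg).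
have := expand 1; under eq_fun do rewrite mul1r; move=> ->.
rewrite expand !complexpE /= => h.
rewrite -subr_ge0; apply: le_trans h _.
by rewrite le_eqVlt; apply/orP; left; apply/eqP; ring.
Qed.

Definition closureL2 V : set (T -> R[i]) := [set f | L2 f /\
  forall e : R, 0 < e -> exists2 g, V g & N2 (fun x => f x - g x) < e].

Lemma sub_closureL2 V : subspaceL2 mu V -> V `<=` closureL2 V.
Proof.
move=> [VL _ _ _] f Vf; split=> [|e e0]; first exact: VL.
by exists f => //; under eq_fun do rewrite subrr; rewrite sqnormL2_0.
Qed.

Lemma subspaceL2_closure V : subspaceL2 mu V -> subspaceL2 mu (closureL2 V).
Proof.
move=> sV; have [VL V0 VD Vae] := sV; split.
- by move=> f [].
- exact: sub_closureL2.
- move=> c f g [hf fV] [hg gV]; split=> [|e e0]; first exact: L2_lin.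
  set K := complex.Re c ^+ 2 + complex.Im c ^+ 2.
  have K0 : 0 <= K by rewrite addr_ge0// sqr_ge0.
  have K1 : 0 < 4 * (K + 1) by rewrite mulr_gt0// ltr_wpDl.
  have [f' Vf' ff'] := fV (e / (4 * (K + 1))) (divr_gt0 e0 K1).
  have [g' Vg' gg'] := gV (e / 4) (divr_gt0 e0 (ltr0n _ 4)).
  exists (fun x => c * f' x + g' x); first exact: VD.
  have -> : (fun x => c * f x + g x - (c * f' x + g' x)) =
      (fun x => c * (f x - f' x) + (g x - g' x)).
    by apply/funext => x; ring.
  have hff' := L2B hf (VL _ Vf'); have hgg' := L2B hg (VL _ Vg').
  apply: le_lt_trans (sqnormL2D (L2Z c hff') hgg') _.
  rewrite sqnormL2Z// -/K.
  have e4 : e = e / 2 + 2 * (e / 4) by field.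
  rewrite [ltRHS]e4; apply: ler_ltD; last by rewrite ltr_pM2l.
  apply: (@le_trans _ _ (2 * ((K + 1) * (e / (4 * (K + 1)))))).
    rewrite ler_pM2l//; apply: ler_pM => //; first exact: sqnormL2_ge0.
      by rewrite lerDl.
    exact: ltW.
  rewrite le_eqVlt; apply/orP; left; apply/eqP; field.
  by rewrite gt_eqF// ltr_wpDl.
- move=> f g [hf fV] hg fg; split=> // e /fV[h Vh fh]; exists h => //.
  rewrite -(@sqnormL2_ae (fun x => f x - h x))//.
  + by apply: L2B => //; exact: VL.
  + by apply: L2B => //; exact: VL.
  + by apply: filterS fg => x ->.
Qed.

Lemma closureL2_closed V f : subspaceL2 mu V -> L2 f ->
  (forall e : R, 0 < e ->
     exists2 g, closureL2 V g & N2 (fun x => f x - g x) < e) ->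
  closureL2 V f.
Proof.
move=> [VL _ _ _] hf fV; split=> // e e0.
have e4 : 0 < e / 4 by rewrite divr_gt0.
have [g [hg gV] fg] := fV _ e4; have [h Vh gh] := gV _ e4.
exists h => //.
have -> : (fun x => f x - h x) = (fun x => (f x - g x) + (g x - h x)).
  by apply/funext => x; ring.
apply: le_lt_trans (sqnormL2D (L2B hf hg) (L2B hg (VL _ Vh))) _.
have -> : e = 2 * (e / 4) + 2 * (e / 4) by field.
by rewrite ltrD// ltr_pM2l.
Qed.

Lemma L2_real a : a \in Lfun mu 2%:E -> L2 (fun x => (a x)%:C%C).
Proof. by move=> ha; split => //=; exact: (L2_0 mu).1. Qed.

Lemma sqnormL2_real a : a \in Lfun mu 2%:E ->
  (N2 (fun x => (a x)%:C%C))%:E = (\int[mu]_x (a x ^+ 2)%:E)%E.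
Proof.
move=> ha; rewrite sqnormL2E; last exact: L2_real.
rewrite [X in _ + X](_ : _ = 0) ?addr0; last first.
  rewrite /dotr/=; under eq_Rintegral do rewrite mul0r.
  by rewrite /Rintegral integral0.
rewrite /dotr/= /Rintegral fineK.
  by under eq_integral do rewrite -expr2.
exact: (integrable_fin_num measurableT (dotr_integrable ha ha)).
Qed.

Import HBNNSimple.

Lemma closureL2_ge0 V a : subspaceL2 mu V ->
  (forall A, measurable A -> closureL2 V \1_A) ->
  a \in Lfun mu 2%:E -> (forall x, 0 <= a x) ->
  closureL2 V (fun x => (a x)%:C%C).
Proof.
move=> sV VI ha a0; have sC := subspaceL2_closure sV.
have ma := Lfun2_measurable ha.
have mEa : measurable_fun setT (EFin \o a) by exact/measurable_EFinP.
pose s := nnsfun_approx measurableT mEa.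
have le_s n x : s n x <= a x.
  rewrite -lee_fin /s nnsfun_approxE; apply: le_approx => // y _.
  by rewrite lee_fin.
have Cs n : closureL2 V (fun x => (s n x)%:C%C).
  under eq_fun do rewrite fimfunEord rmorph_sum.
  apply: (subspaceL2_sum (mu := mu)) => // i _.
  set r := (fset_set _)`_i.
  have mr : measurable (s n @^-1` [set r]) by exact: measurable_funPTI.
  have := subspaceL2_scale r%:C%C sC (VI _ mr).
  congr (closureL2 V _); apply/funext => x.
  by rewrite rmorphM/= !indicE rmorph_nat.
have Ls n : (fun x => (s n x)) \in Lfun mu 2%:E.
  apply: Lfun2P; first exact: measurable_funP.
  apply: le_integrable (Lfun2_integrable_sqr ha) => //.
    by apply/measurable_EFinP; apply: measurable_funX; exact: measurable_funP.
  move=> x _; rewrite lee_fin /= !ger0_norm ?sqr_ge0// lerXn2r ?nnegrE//.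
apply: closureL2_closed => //; first exact: L2_real.
move=> e e0.
have : (fun n => \int[mu]_x ((a x - s n x) ^+ 2)%:E)%E @ \oo --> 0%E.
  have [] := @dominated_convergence _ T R mu setT measurableT
    (fun n x => ((a x - s n x) ^+ 2)%:E) (cst 0%E) (fun x => (a x ^+ 2)%:E).
  - move=> n; apply/measurable_EFinP; apply: measurable_funX.
    by apply: measurable_funB => //; exact: measurable_funP.
  - exact: measurable_cst.
  - apply: aeW => x _; rewrite -[X in _ --> X]/((0 : R)%:E).
    apply: cvg_EFin; first exact: nearW.
    have := cvg_nnsfun_approx measurableT mEa (fun x _ => a0 x) (I : setT x).
    move=> /fine_cvgP[_ sa].
    have : (fun n => (a x - s n x) ^+ 2) @ \oo --> (a x - a x) ^+ 2.
      by apply: cvgM; apply: cvgB => //; exact: cvg_cst.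
    by rewrite subrr expr0n.
  - exact: Lfun2_integrable_sqr.
  - apply: aeW => x n _; rewrite lee_fin ger0_norm ?sqr_ge0//.
    by rewrite lerXn2r ?nnegrE// ?subr_ge0// gerBl.
  by move=> _ _; rewrite integral0.
move=> /fine_cvgP[_ /cvgrPdist_lt/(_ e e0)] [n _ /(_ n (leqnn n))] /=.
rewrite sub0r normrN => h; exists (fun x => (s n x)%:C%C) => //.
have -> : (fun x => (a x)%:C%C - (s n x)%:C%C) = (fun x => (a x - s n x)%:C%C).
  by apply/funext => x; rewrite rmorphB.
have -> : N2 (fun x => (a x - s n x)%:C%C) =
    fine (\int[mu]_x ((a x - s n x) ^+ 2)%:E)%E.
  rewrite -sqnormL2_real//; under eq_fun do rewrite -mulN1r.
  by apply: Lfun2D => //; exact: Lfun2Z.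
exact: le_lt_trans (ler_norm _) h.
Qed.

Lemma closureL2_indic V f : subspaceL2 mu V ->
  (forall A, measurable A -> closureL2 V \1_A) -> L2 f -> closureL2 V f.
Proof.
move=> sV VI [f1 f2]; have sC := subspaceL2_closure sV.
have real a : a \in Lfun mu 2%:E -> closureL2 V (fun x => (a x)%:C%C).
  move=> ha; have ma := Lfun2_measurable ha.
  have part (b : T -> R) : measurable_fun setT b -> (forall x, 0 <= b x) ->
      (forall x, b x <= `|a x|) -> closureL2 V (fun x => (b x)%:C%C).
    move=> mb b0 ba; apply: closureL2_ge0 => //; apply: Lfun2P => //.
    apply: le_integrable (Lfun2_integrable_sqr ha) => //.
      by apply/measurable_EFinP; exact: measurable_funX.
    move=> x _; rewrite lee_fin /= !ger0_norm ?sqr_ge0//.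
    rewrite -(real_normK (num_real (a x))).
    by rewrite lerXn2r ?nnegrE.
  have -> : (fun x => (a x)%:C%C) = (fun x => (a^\+ x)%:C%C - (a^\- x)%:C%C).
    by apply/funext => x; rewrite -rmorphB /= -[in LHS](funrposBneg a).
  apply: (subspaceL2_sub sC); apply: part.
  - exact: measurable_funrpos.
  - exact: funrpos_ge0.
  - by move=> x; rewrite /funrpos ge_max normr_ge0 ler_norm.
  - exact: measurable_funrneg.
  - exact: funrneg_ge0.
  - by move=> x; rewrite /funrneg ge_max normr_ge0 -normrN ler_norm.
have -> : f = (fun x =>
    'i%C * (complex.Im (f x))%:C%C + (complex.Re (f x))%:C%C).
  by apply/funext => x; rewrite addrC -complexE.
by have [_ _ CD _] := sC; apply: CD; exact: real.
Qed.

End SquareNorm.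

Section Indicators.
Context d (T : measurableType d) (R : realType).
Variable mu : {finite_measure set T -> \bar R}.
Implicit Types (A B C : set T) (V : set (T -> R[i])).
Local Notation L2 := (L2 mu).
Local Notation dot := (dotL2 mu).
Local Notation chi A := (\1_A : T -> R[i]).

Lemma indic_realE A : chi A = (fun x => (\1_A x : R)%:C%C).
Proof. by apply/funext => x; rewrite !indicE rmorph_nat. Qed.

Lemma Lfun2_indic A : measurable A -> (\1_A : T -> R) \in Lfun mu 2%:E.
Proof.
move=> mA; apply: Lfun2P; first exact: measurable_indic.
rewrite (_ : _ \o _ = fun x => (\1_A x)%:E); first exact: integrable_indic.
by apply/funext => x /=; rewrite indicE -natrX; case: (x \in A).
Qed.

Lemma L2_indic A : measurable A -> L2 (chi A).
Proof. by move=> mA; rewrite indic_realE; apply/L2_real/Lfun2_indic. Qed.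

Lemma dotL2_indic A B : measurable A -> measurable B ->
  dot (chi A) (chi B) = (fine (mu (A `&` B)))%:C%C.
Proof.
move=> mA mB; rewrite dotL2E; [|exact: L2_indic..].
rewrite !indic_realE /=.
have z a : dotr mu a (fun=> 0) = 0.
  rewrite /dotr; under eq_Rintegral do rewrite mulr0.
  by rewrite /Rintegral integral0.
rewrite !(dotrC _ (fun=> 0)) !z subr0 addr0; congr Complex.
rewrite /dotr /Rintegral -[in RHS](setIT (A `&` B)) -integral_indic//.
  by congr fine; apply: eq_integral => x _; rewrite indicI.
exact: measurableI.
Qed.

Lemma sqnormL2_indic A : measurable A -> sqnormL2 mu (chi A) = fine (mu A).
Proof. by move=> mA; rewrite /sqnormL2 dotL2_indic// setIid. Qed.

Lemma L2_nchi A : measurable A -> L2 (nchi mu A).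
Proof. by move=> mA; apply: L2Z; exact: L2_indic. Qed.

Lemma nchiE A : fine (mu A) != 0 ->
  chi A = (fun x => (fine (mu A))%:C%C * nchi mu A x).
Proof.
move=> A0; apply/funext => x.
by rewrite /nchi mulrA -rmorphM /= divff// mul1r.
Qed.

Lemma dotL2_indic_nchi A B : measurable A -> measurable B ->
  dot (chi A) (nchi mu B) = ((fine (mu B))^-1 * fine (mu (A `&` B)))%:C%C.
Proof.
by move=> mA mB; rewrite dotL2Zr ?dotL2_indic ?rmorphM//; exact: L2_indic.
Qed.

Lemma dotL2_indic_nchiB A B C :
  measurable A -> measurable B -> measurable C ->
  fine (mu B) != 0 -> fine (mu C) != 0 ->
  (B `<=` A /\ C `<=` A) \/ (A `&` B = set0 /\ A `&` C = set0) ->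
  dot (chi A) (fun x => nchi mu B x - nchi mu C x) = 0.
Proof.
move=> mA mB mC B0 C0 h; have hA := L2_indic mA.
rewrite dotL2Br//; [|exact: L2_nchi..].
rewrite !dotL2_indic_nchi//; case: h => -[hB hC].
  by rewrite (setIidr hB) (setIidr hC) !mulVf// subrr.
by rewrite hB hC measure0 /= !mulr0 subrr.
Qed.

Lemma fine_measure_partition (I : Type) (s : seq I) (A : set T)
    (B : I -> set T) :
  measurable A -> (forall i, measurable (B i)) ->
  chi A = (fun x => \sum_(i <- s) chi (B i) x) ->
  fine (mu A) = \sum_(i <- s) fine (mu (B i)).
Proof.
move=> mA mB AE; apply: (@complexI R); rewrite rmorph_sum /=.
have L1 := L2_indic (measurableT : measurable [set: T]).
have dotT C : measurable C -> dot (chi setT) (chi C) = (fine (mu C))%:C%C.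
  by move=> mC; rewrite dotL2_indic// setTI.
rewrite -dotT// AE; under [RHS]eq_bigr do rewrite -dotT//.
elim: s {AE} => [|i t IH].
  by under eq_fun do rewrite big_nil; rewrite big_nil dotL20.
under eq_fun do rewrite big_cons -[X in X + _]mul1r; rewrite big_cons.
rewrite dotL2_linr ?mul1r ?IH//; first exact: L2_indic.
apply: (subspaceL2_sum (mu := mu)) => [|k _]; last exact: L2_indic.
split=> //; [exact: L2_0 | by move=> c f g; exact: L2_lin].
Qed.

(* Writing [chi A_j = mu A_j *: n_j] and [chi A = \sum_i mu A_i *: n_i], where
   [n_i = nchi A_i], one has
   [chi A_j - (mu A_j / mu A) chi A =
    (mu A_j / mu A) \sum_i mu A_i (n_j - n_i)]. *)
Lemma indic_partition_mem V (I : eqType) (s : seq I) (A : set T)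
    (B : I -> set T) :
  subspaceL2 mu V -> measurable A -> (forall i, measurable (B i)) ->
  (forall i, i \in s -> fine (mu (B i)) != 0) ->
  fine (mu A) != 0 ->
  chi A = (fun x => \sum_(i <- s) chi (B i) x) ->
  V (chi A) ->
  (forall i j, i \in s -> j \in s -> i <> j ->
     V (fun x => nchi mu (B i) x - nchi mu (B j) x)) ->
  forall j, j \in s -> V (chi (B j)).
Proof.
move=> sV mA mB B0 A0 AE VA VB j js.
have V0 : V (fun=> 0) by case: sV.
pose m i := (fine (mu (B i)))%:C%C : R[i].
have mAE : (fine (mu A))%:C%C = \sum_(i <- s) m i.
  by rewrite (fine_measure_partition mA mB AE) rmorph_sum.
have mA0 : (fine (mu A))%:C%C != 0 :> R[i].
  by rewrite -(rmorph0 (real_complex R)) (inj_eq (@complexI _)).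
pose c := m j / (fine (mu A))%:C%C.
have -> : chi (B j) = (fun x => c * chi A x +
    \sum_(i <- s) (c * m i) * (nchi mu (B j) x - nchi mu (B i) x)).
  apply/funext => x; rewrite AE.
  under [in X in _ + X]eq_bigr do rewrite mulrBr.
  rewrite sumrB -mulr_suml -mulr_sumr -mAE /c divfK//.
  rewrite {1}(nchiE (B0 _ js)) -/(m j).
  rewrite [X in _ = X + _]mulr_sumr.
  rewrite [X in _ = _ + (_ - X)](_ : _ = \sum_(i <- s) c * chi (B i) x).
    by rewrite addrC subrK.
  rewrite big_seq [RHS]big_seq; apply: eq_bigr => i si.
  by rewrite (nchiE (B0 _ si)) -/(m i) [RHS]mulrA.
have [_ _ VD _] := sV; apply: VD => //.
rewrite (_ : (fun x => _) = (fun x => \sum_(i <- s | i \in s)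
   (c * m i) * (nchi mu (B j) x - nchi mu (B i) x))); last first.
  by apply/funext => x; rewrite big_seq.
apply: (subspaceL2_sum (mu := mu)) => // i si.
apply: (subspaceL2_scale (mu := mu)) => //.
have [->|ij] := eqVneq j i; last by apply: VB => //; exact/eqP.
by under eq_fun do rewrite subrr.
Qed.

Lemma closureL2_pi (G : set (set T)) V f : subspaceL2 mu V ->
  setI_closed G -> measurable = <<s G >> -> V (chi setT) ->
  (forall A, G A -> V (chi A)) -> L2 f -> closureL2 mu V f.
Proof.
move=> sV GI mE VT VG hf; have sC := subspaceL2_closure sV.
apply: closureL2_indic => // A; rewrite mE => sA.
pose H := [set A : set T | measurable A /\ closureL2 mu V (chi A)].
suff : H A by case.
apply: (@lambda_system_subset _ G GI setT H) => //; last first.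
  move=> B GB; split; last exact/(sub_closureL2 sV)/VG.
  by rewrite mE; exact: sub_sigma_algebra.
split=> //.
- by split=> //; exact: (sub_closureL2 sV).
- move=> B C CB [mB VB] [mC VC]; split; first exact: measurableD.
  rewrite (_ : chi _ = (fun x => chi B x - chi C x)).
    exact: (subspaceL2_sub sC).
  apply/funext => x; rewrite !indicE in_setD.
  have [xC|xC] := boolP (x \in C); last by rewrite andbT subr0.
  by rewrite andbF (_ : x \in B) ?subrr// inE; apply: CB; rewrite inE in xC.
- move=> F ndF HF; have mF n : measurable (F n) by case: (HF n).
  have mU : measurable (\bigcup_n F n) by exact: bigcupT_measurable.
  split=> //; apply: closureL2_closed => // [|e e0]; first exact: L2_indic.
  have /fine_cvgP[_ /cvgrPdist_lt/(_ e e0)] :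
      mu \o F @ \oo --> (fine (mu (\bigcup_n F n)))%:E.
    by rewrite fineK ?fin_num_measure//; exact: nondecreasing_cvg_mu.
  move=> [n _ /(_ n (leqnn n))] /= nE.
  exists (chi (F n)); first by case: (HF n).
  have sub : F n `<=` \bigcup_n F n by exact: bigcup_sup.
  rewrite (_ : (fun x => _) = chi ((\bigcup_n F n) `\` F n)); last first.
    apply/funext => x; rewrite !indicE in_setD.
    have [xC|xC] := boolP (x \in F n); last by rewrite andbT subr0.
    by rewrite andbF (_ : x \in _) ?subrr// inE; apply: sub; rewrite inE in xC.
  rewrite sqnormL2_indic; last exact: measurableD.
  rewrite measureD// ?fin_num_fun_lty//; last first.
    by rewrite -ge0_fin_numE//; exact: fin_num_measure.
  rewrite (setIidr sub) fineB ?fin_num_measure//.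
  exact: le_lt_trans (ler_norm _) nE.
Qed.

End Indicators.

(** * Cylinders of the path space *)

Section Cylinders.
Variables (k : nat) (L : kgraph k).
Implicit Types (x : infpath L) (l e : mor L) (m n : multideg k).

Definition diag_deg (n : nat) : multideg k := [ffun=> n].

Lemma md_leD m n : md_le m (m + n).
Proof. by apply/forallP => i; rewrite ffunE; exact: leq_addr. Qed.

Lemma md_leDsub m n : md_le m n -> exists p, n = m + p.
Proof.
move=> /forallP mn; exists [ffun i => (n i - m i)%N].
by apply/ffunP => i; rewrite !ffunE [RHS]subnKC.
Qed.

Definition ip_init x n : mor L := ip_mor x (md_le0 n).

Lemma src_ip_mor x m n (mn : md_le m n) : src (ip_mor x mn) = fobj x n.
Proof. exact: fmor_src. Qed.

Lemma rng_ip_mor x m n (mn : md_le m n) : rng (ip_mor x mn) = fobj x m.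
Proof. exact: fmor_rng. Qed.

Lemma deg_ip_mor x m n (mn : md_le m n) :
  deg (ip_mor x mn) = [ffun i => (n i - m i)%N].
Proof. exact: fmor_deg. Qed.

Lemma deg_ip_init x n : deg (ip_init x n) = n.
Proof. by rewrite deg_ip_mor; apply/ffunP => i; rewrite !ffunE subn0. Qed.

Lemma ip_init_comp x m n (mn : md_le m n) :
  ip_init x n = Defs.comp (ip_init x m) (ip_mor x mn).
Proof.
rewrite /ip_init /ip_mor -(@fmor_comp k (Omega k) L)//; congr fmor.
by apply: omega_eq; rewrite ?omega_rng_comp ?omega_src_comp.
Qed.

Lemma comp_deg_inj l e l' e' : src l = rng e -> src l' = rng e' ->
  deg l = deg l' -> deg e = deg e' -> Defs.comp l e = Defs.comp l' e' ->
  l = l' /\ e = e'.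
Proof.
move=> le le' dl de lele'.
have [p [_ pu]] := factorization (deg_comp le).
have : p = (l', e') by apply: pu; rewrite /= -dl -de -lele'.
by have -> : p = (l, e) by [exact: pu]; case.
Qed.

Lemma idm_inj : injective (@idm k L).
Proof. by move=> v w /(congr1 rng); rewrite !rng_id. Qed.

Lemma deg0_idm l : deg l = 0 -> l = idm (rng l).
Proof.
move=> l0; have [] // := @comp_deg_inj l (idm (src l)) (idm (rng l)) l.
- by rewrite rng_id.
- by rewrite src_id.
- by rewrite l0 deg_id.
- by rewrite l0 deg_id.
- by rewrite comp_idl comp_idr.
Qed.

Lemma cyl_init x n : cyl (ip_init x n) x.
Proof. by rewrite /cyl /= -/(ip_init x _) deg_ip_init. Qed.

Lemma cyl_inj x l l' : cyl l x -> cyl l' x -> deg l = deg l' -> l = l'.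
Proof.
by rewrite /cyl /= -!/(ip_init x _) => <- <-; rewrite !deg_ip_init => ->.
Qed.

Lemma cyl_comp x l e m n (mn : md_le m n) : src l = rng e -> deg l = m ->
  deg (Defs.comp l e) = n ->
  cyl (Defs.comp l e) x <-> cyl l x /\ ip_mor x mn = e.
Proof.
move=> le lm len; rewrite /cyl /= -!/(ip_init x _) len lm (ip_init_comp x mn).
split=> [|[-> ->]//] h.
have dmn : deg (ip_mor x mn) = deg e.
  rewrite deg_ip_mor; apply/ffunP => i; rewrite ffunE -len deg_comp// ffunE lm.
  exact: addKn.
by apply: comp_deg_inj h => //; rewrite ?deg_ip_init// src_ip_mor rng_ip_mor.
Qed.

Lemma cyl_comp_sub l e : src l = rng e -> cyl (Defs.comp l e) `<=` cyl l.
Proof.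
move=> le x.
by case/(cyl_comp _ (md_leD (deg l) (deg e)) le erefl (deg_comp le)).
Qed.

Lemma cyl_nested x l l' : cyl l x -> cyl l' x -> md_le (deg l) (deg l') ->
  cyl l' `<=` cyl l.
Proof.
rewrite {1 2}/cyl /= -!/(ip_init x _) => lx l'x ll'.
have [b lb ->] : exists2 b, src l = rng b & l' = Defs.comp l b.
  exists (ip_mor x ll'); first by rewrite rng_ip_mor -[in LHS]lx src_ip_mor.
  by rewrite -[LHS]l'x (ip_init_comp x ll') lx.
exact: cyl_comp_sub.
Qed.

Lemma cyl_idm v x : cyl (idm v) x <-> fobj x 0 = v.
Proof.
rewrite /cyl /= -/(ip_init x _) deg_id.
have -> : ip_init x 0 = idm (fobj x 0).
  have := deg0_idm (deg_ip_init x 0).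
  by rewrite rng_ip_mor.
by split=> [/idm_inj|->].
Qed.

Lemma open_cyl l : open (cyl l).
Proof.
exists [set cyl l]; last by rewrite bigcup_set1.
move=> _ ->; exists [fset (cyl l)]%fset; last by rewrite set_fset1 bigcap_set1.
by move=> A /fset1P ->; rewrite inE; exists l.
Qed.

Lemma open_cylP (U : set (infpath L)) x : open U -> U x ->
  exists n : nat, cyl (ip_init x (diag_deg n)) `<=` U.
Proof.
case=> D DF <- [A /= DA Ax]; have [F Fcyl FA] := DF _ DA.
suff [n nF] : exists n : nat,
    forall B, B \in F -> cyl (ip_init x (diag_deg n)) `<=` B.
  exists n => y yn; exists A => //=; rewrite -FA => B BF.
  by apply: nF yn.
have Fx B : B \in F -> exists2 l, B = cyl l & cyl l x.
  move=> BF; have /set_mem [l _ lB] := Fcyl _ BF.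
  by exists l => //; rewrite lB; move: Ax; rewrite -FA => /(_ B BF).
suff common (s : seq (set (infpath L))) :
    (forall B, B \in s -> exists2 l, B = cyl l & cyl l x) ->
    exists n : nat, forall B, B \in s -> cyl (ip_init x (diag_deg n)) `<=` B.
  exact: common Fx.
elim: s => [|B s IH] sx; first by exists 0%N.
have [|n ns] := IH; first by move=> C Cs; apply: sx; rewrite inE Cs orbT.
have [l Bl lx] := sx B (mem_head _ _).
exists (maxn n (\max_i deg l i)) => C; rewrite inE => /predU1P[->|Cs].
- rewrite Bl; apply: (cyl_nested (x := x)) => //; first exact: cyl_init.
  rewrite deg_ip_init; apply/forallP => i; rewrite ffunE.
  by rewrite leq_max; apply/orP; right; exact: leq_bigmax.
- apply: subset_trans (ns _ Cs); apply: (cyl_nested (x := x)).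
  + exact: cyl_init.
  + exact: cyl_init.
  + rewrite !deg_ip_init; apply/forallP => i; rewrite !ffunE.
    exact: leq_maxl.
Qed.

Definition diag_cyl : set (set (infpath L)) :=
  [set A | A = set0 \/ exists l (n : nat), deg l = diag_deg n /\ A = cyl l].

Lemma diag_cyl_setI : setI_closed diag_cyl.
Proof.
move=> A B [->|[l [n [ln ->]]]]; first by rewrite set0I; left.
move=> [->|[l' [n' [ln' ->]]]]; first by rewrite setI0; left.
have [->|/set0P[x [lx lx']]] := eqVneq (cyl l `&` cyl l') set0; first by left.
right; have [nn'|/ltnW nn'] := leqP n n'.
  exists l', n'; split=> //; apply: setIidr.
  apply: cyl_nested lx lx' _; rewrite ln ln'.
  by apply/forallP => i; rewrite !ffunE.
exists l, n; split=> //; apply: setIidl.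
apply: cyl_nested lx' lx _; rewrite ln ln'.
by apply/forallP => i; rewrite !ffunE.
Qed.

Lemma borel_diag_cyl : <<s @open (infpath L) >> = <<s diag_cyl >>.
Proof.
have sG := smallest_sigma_algebra setT diag_cyl.
apply/seteqP; split; apply: smallest_sub; try exact: smallest_sigma_algebra.
- move=> U oU.
  pose F i : set (infpath L) := if choice.unpickle i is Some l then
    if `[< (exists n : nat, deg l = diag_deg n) /\ cyl l `<=` U >] then cyl l
    else set0 else set0.
  have -> : U = \bigcup_i F i.
    apply/seteqP; split=> [x Ux|x [i _]].
    - have [n nU] := open_cylP oU Ux.
      exists (choice.pickle (ip_init x (diag_deg n))) => //.
      rewrite /F choice.pickleK.
      case: asboolP => [_|[]]; first exact: cyl_init.
      by split=> //; exists n; rewrite deg_ip_init.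
    - rewrite /F; case: choice.unpickle => // l.
      by case: asboolP => // -[_]; exact.
  case: sG => s0 _; apply => i; rewrite /F; case: choice.unpickle => // l.
  case: asboolP => // -[[n ln] _].
  by apply: sub_sigma_algebra; right; exists l, n.
- move=> _ [->|[l [n [_ ->]]]].
    by case: (smallest_sigma_algebra setT (@open (infpath L))).
  by apply: sub_sigma_algebra; exact: open_cyl.
Qed.

End Cylinders.

Lemma indic_partition (T : Type) (R : nzRingType) (I : eqType) (s : seq I)
    (A : set T) (B : I -> set T) : uniq s ->
  (forall x, A x -> exists2 i, i \in s & B i x) ->
  (forall i, i \in s -> B i `<=` A) ->
  (forall x i j, i \in s -> j \in s -> B i x -> B j x -> i = j) ->
  (\1_A : T -> R) = (fun x => \sum_(i <- s) \1_(B i) x).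
Proof.
move=> us AB BA BB; apply/funext => x; rewrite indicE.
have [xA|xA] := boolP (x \in A).
  have [i si Bix] := AB x (set_mem xA).
  rewrite (bigD1_seq i)//= indicE mem_set// big_seq_cond big1 ?addr0//.
  move=> j /andP[sj ji]; rewrite indicE memNset// => Bjx.
  by move/eqP: ji; apply; exact: BB Bjx Bix.
rewrite big_seq big1// => i si; rewrite indicE memNset// => Bix.
by move/negP: xA; apply; apply: mem_set; exact: BA Bix.
Qed.

Section Extensions.
Variables (k : nat) (L : kgraph k).
Hypothesis Lfin : kg_finite L.
Implicit Types (x : infpath L) (l e : mor L) (m n : multideg k).

Definition mors n : seq (mor L) := fset_set [set l : mor L | deg l = n].

Lemma mem_mors n l : (l \in mors n) = (deg l == n).
Proof.
by rewrite in_fset_set//; apply/idP/eqP => [/set_mem//|ln]; exact: mem_set.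
Qed.

Definition exts v n : seq (mor L) := [seq e <- mors n | rng e == v].

Lemma mem_exts v n e : (e \in exts v n) = (rng e == v) && (deg e == n).
Proof. by rewrite mem_filter mem_mors. Qed.

Lemma indic_setT_mors (R : nzRingType) n :
  (\1_setT : infpath L -> R) = (fun x => \sum_(l <- mors n) \1_(cyl l) x).
Proof.
apply: indic_partition => //; first exact: fset_uniq.
  move=> x _; exists (ip_init x n); last exact: cyl_init.
  by rewrite mem_mors deg_ip_init.
move=> x l l'; rewrite !mem_mors => /eqP ln /eqP l'n lx l'x.
by apply: cyl_inj lx l'x _; rewrite ln.
Qed.

Lemma indic_cyl_exts (R : nzRingType) l m :
  (\1_(cyl l) : infpath L -> R) =
  (fun x => \sum_(e <- exts (src l) m) \1_(cyl (Defs.comp l e)) x).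
Proof.
apply: indic_partition.
- by rewrite filter_uniq// fset_uniq.
- move=> x lx; have lE : ip_init x (deg l) = l := lx.
  pose e := ip_mor x (md_leD (deg l) m).
  have de : deg e = m.
    by rewrite deg_ip_mor; apply/ffunP => i; rewrite !ffunE; exact: addKn.
  have le : rng e = src l by rewrite rng_ip_mor -[in RHS]lE src_ip_mor.
  exists e; first by rewrite mem_exts de le !eqxx.
  have dle : deg (Defs.comp l e) = deg l + m by rewrite deg_comp// de.
  by apply/(cyl_comp _ (md_leD (deg l) m) _ erefl dle).
- by move=> e; rewrite mem_exts => /andP[/eqP le _]; exact: cyl_comp_sub.
- move=> x e e'; rewrite !mem_exts.
  move=> /andP[/eqP le /eqP dle] /andP[/eqP le' /eqP dle'].
  move=> lx lx'; have [] // := @comp_deg_inj _ _ l e l e'; first by rewrite dle.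
  by apply: cyl_inj lx lx' _; rewrite !deg_comp// dle dle'.
Qed.

End Extensions.

Section BratteliMorphisms.
Variables (k : nat) (L : kgraph k).
Implicit Types (v : obj L) (p : seq (mor L)) (e l : mor L).

Definition bmor v p : mor L := foldl (@Defs.comp k L) (idm v) p.

Lemma bmor_rcons v p e : bmor v (rcons p e) = Defs.comp (bmor v p) e.
Proof. exact: foldl_rcons. Qed.

Lemma is_bpath_rcons n v p e : is_bpath n v (rcons p e) =
  [&& is_bpath n v p, rng e == last v (map src p) &
      deg e == bdegree k (n + size p)].
Proof.
elim: p n v => [|a p IH] n v /=; first by rewrite addn0 andbT.
by rewrite IH addSnnS !andbA.
Qed.

Lemma bsumdeg0 : bsumdeg k 0 = 0.
Proof. by apply/ffunP => i; rewrite !ffunE div0n mod0n. Qed.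

Lemma bsumdeg_diag n : (0 < k)%N -> bsumdeg k (n * k) = diag_deg k n.
Proof. by move=> k0; apply/ffunP => i; rewrite !ffunE mulnK// modnMl addn0. Qed.

Lemma bsumdeg_le m n : (m <= n)%N -> md_le (bsumdeg k m) (bsumdeg k n).
Proof.
move=> /subnKC <-; elim: (n - m)%N => [|i IH].
  by rewrite addn0; exact: md_le_refl.
by rewrite addnS; apply: md_le_trans IH (bsumdeg_leS _ _).
Qed.

Lemma bmor_props v p : is_bpath 0 v p ->
  [/\ src (bmor v p) = last v (map src p), deg (bmor v p) = bsumdeg k (size p) &
      bcyl_inf v p = cyl (bmor v p)].
Proof.
elim/last_ind: p => [_|p e IH].
  split; rewrite /= ?src_id ?deg_id ?bsumdeg0//.
  apply/seteqP; split=> [x [xv _]|x /cyl_idm xv]; [apply/cyl_idm|split=> //].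
    by rewrite -xv /xrng /= rng_ip_mor bsumdeg0.
  by rewrite /xrng /= rng_ip_mor bsumdeg0.
rewrite is_bpath_rcons add0n => /and3P[/IH[ps pd pc] /eqP re /eqP de].
have pe : src (bmor v p) = rng e by rewrite ps re.
rewrite bmor_rcons map_rcons last_rcons size_rcons.
have dpe : deg (Defs.comp (bmor v p) e) = bsumdeg k (size p).+1.
  by rewrite deg_comp// pd de bsumdegS.
split=> //; first exact: src_comp.
apply/seteqP; split=> x.
- move=> [xv]; rewrite size_rcons mkseqS => /rcons_inj[xp xe].
  apply/(cyl_comp _ (bsumdeg_leS k (size p)) pe pd dpe); split=> //.
  by rewrite -pc; split.
- move=> /(cyl_comp _ (bsumdeg_leS k (size p)) pe pd dpe)[].
  rewrite -pc => -[xv xp] xe; split=> //.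
  by rewrite size_rcons mkseqS xp -xe.
Qed.

Lemma bmor_surj m l : deg l = bsumdeg k m ->
  exists p, [/\ is_bpath 0 (rng l) p, size p = m & bmor (rng l) p = l].
Proof.
elim: m l => [|m IH] l; first by rewrite bsumdeg0 => /deg0_idm l0; exists [::].
rewrite bsumdegS => /factorization[[a e] [[/= da de ae ->] _]].
have [p [pp pm pa]] := IH a da; exists (rcons p e).
have [ps _ _] := bmor_props pp.
rewrite rng_comp// is_bpath_rcons pp size_rcons pm add0n bmor_rcons pa -ps pa.
by rewrite ae de !eqxx.
Qed.

End BratteliMorphisms.

(** * The wavelet and eigenspace decompositions *)

Section Decomposition.
Variables (R : realType) (k : nat) (L : kgraph k) (x0 : infpath L).
Variable M : probability (borel_infpath x0) R.
Hypothesis k0 : (0 < k)%N.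
Hypothesis Lfin : kg_finite L.
Variable x : obj L -> R.
Hypothesis x_gt0 : forall v, 0 < x v.
Hypothesis hM : is_graph_measure M x.
Local Notation T := (borel_infpath x0).
Local Notation chi A := (\1_(A : set T) : T -> R[i]).
Implicit Types (l e : mor L) (g : bpath L) (v : obj L) (p : seq (mor L)).

Lemma measurable_cyl l : measurable (cyl l : set T).
Proof. by apply: sub_sigma_algebra; exact: open_cyl. Qed.

Lemma fine_cyl l :
  fine (M (cyl l)) = (\prod_(i < k) rho L R i ^- deg l i) * x (src l).
Proof. exact: (congr1 fine (hM l)). Qed.

Lemma rho_neq0 i : rho L R i != 0.
Proof.
apply/eqP => r0.
have mT := indic_setT_mors Lfin R[i] (ebasis k i).
have : fine (M setT) = \sum_(l <- mors L (ebasis k i)) fine (M (cyl l)).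
  exact: (fine_measure_partition M measurableT measurable_cyl mT).
rewrite probability_setT /= big_seq big1 => [/eqP|l]; first by rewrite oner_eq0.
rewrite mem_mors// => /eqP dl.
transitivity ((\prod_(i < k) rho L R i ^- deg l i) * x (src l)).
  exact: fine_cyl.
have di : deg l i = 1%N by rewrite dl ffunE eqxx.
rewrite (bigD1 i)//=.
by rewrite di r0 expr1 invr0 !mul0r.
Qed.

Lemma fine_cyl_neq0 l : fine (M (cyl l)) != 0.
Proof.
rewrite fine_cyl mulf_neq0 ?(gt_eqF (x_gt0 _))//.
by apply/prodf_neq0 => i _; rewrite invr_eq0 expf_neq0// rho_neq0.
Qed.

Lemma L2_waveletV_gen n :
  [set f : T -> R[i] | exists2 l : mor L, deg l = [ffun=> n] & f = chi (cyl l)]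
    `<=` L2 M.
Proof. by move=> _ [l _ ->]; apply: L2_indic; exact: measurable_cyl. Qed.

Lemma waveletV_cyl l n : md_le (deg l) (diag_deg k n) ->
  waveletV M n (chi (cyl l)).
Proof.
move=> /md_leDsub[m nE]; rewrite (indic_cyl_exts Lfin _ l m).
under eq_fun do rewrite big_seq.
apply: (subspaceL2_sum (mu := M)) => [|e]; first exact: subspaceL2_span.
rewrite mem_exts// => /andP[/eqP le /eqP em].
apply: spanL2_gen; first exact: L2_waveletV_gen.
by exists (Defs.comp l e) => //; rewrite deg_comp// em -nE.
Qed.

Lemma waveletV_le m n : (m <= n)%N -> waveletV M m `<=` waveletV M n.
Proof.
move=> mn; apply: spanL2_min; first exact: subspaceL2_span.
move=> _ [l lm ->]; apply: waveletV_cyl; rewrite lm.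
by apply/forallP => i; rewrite !ffunE.
Qed.

Lemma waveletV_L2 n : waveletV M n `<=` L2 M.
Proof. by move=> f []. Qed.

Lemma waveletW_L2 n : waveletW M n `<=` L2 M.
Proof. by move=> f [] /waveletV_L2. Qed.

Lemma subspaceL2_waveletW n : subspaceL2 M (waveletW M n).
Proof.
have [VL V0 VD Vae] : subspaceL2 M (waveletV M n.+1) by exact: subspaceL2_span.
have [_ O0 OD Oae] := subspaceL2_orth (@waveletV_L2 n).
split.
- exact: waveletW_L2.
- by split=> //; case: O0.
- move=> c f g [Vf Of] [Vg Og]; split; first exact: VD.
  by have [] := OD c f g (conj (VL _ Vf) Of) (conj (VL _ Vg) Og).
- move=> f g [Vf Of] hg fg; split; first exact: Vae fg.
  by have [] := Oae f g (conj (VL _ Vf) Of) hg fg.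
Qed.

Lemma bcyl_infE v p : is_bpath 0 v p ->
  bcyl_inf v p = cyl (bmor v p) :> set T.
Proof. by case/bmor_props. Qed.

Lemma measurable_bcyl_inf v p : is_bpath 0 v p ->
  measurable (bcyl_inf v p : set T).
Proof. by move=> vp; rewrite bcyl_infE//; exact: measurable_cyl. Qed.

Lemma ext1_bpath g (p : mor L * mor L) : ext1 g p ->
  is_bpath 0 (bp_rng g) (rcons (bp_edges g) p.1) /\
  is_bpath 0 (bp_rng g) (rcons (bp_edges g) p.2).
Proof.
move=> [_ d1 d2 r1 r2]; rewrite !is_bpath_rcons (bpathP g) !add0n.
by rewrite d1 d2 r1 r2 !eqxx.
Qed.

Definition eigen_level n : set (T -> R[i]) :=
  \bigcup_(g in [set g : bpath L | exists2 t : nat,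
    (t < k)%N & bp_len g = (n * k + t)%N]) eigen_path M g.

Lemma eigen_path_gen_L2 g (p : mor L * mor L) : ext1 g p ->
  L2 M (fun x => nchi M (bcyl_inf (bp_rng g) (rcons (bp_edges g) p.1)) x -
                 nchi M (bcyl_inf (bp_rng g) (rcons (bp_edges g) p.2)) x).
Proof.
move=> /ext1_bpath[p1 p2].
by apply: L2B; apply: L2_nchi; exact: measurable_bcyl_inf.
Qed.

Lemma eigen_level_L2 n : eigen_level n `<=` L2 M.
Proof. by move=> f [g _ []]. Qed.

Lemma eigen_level_sub n : spanL2 M (eigen_level n) `<=` waveletW M n.
Proof.
have sW := subspaceL2_waveletW n.
apply: spanL2_min => // f [g [t tk gt]].
apply: spanL2_min sW _ f => _ [p gp ->].
have [p1 p2] := ext1_bpath gp; have [_ d1 d2 r1 r2] := gp.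
have hL := eigen_path_gen_L2 gp; rewrite !bcyl_infE// in hL *.
have [gs gd _] := bmor_props (bpathP g).
rewrite !bmor_rcons in hL *.
have [c1 c2] : src (bmor (bp_rng g) (bp_edges g)) = rng p.1 /\
    src (bmor (bp_rng g) (bp_edges g)) = rng p.2.
  by rewrite gs r1 r2.
have le_n i : deg (bmor (bp_rng g) (bp_edges g)) + bdegree k (bp_len g) =
    bsumdeg k (n * k + t).+1.
  by rewrite gd bsumdegS -gt.
split.
- apply: (subspaceL2_sub (mu := M)); first exact: subspaceL2_span.
  + apply: (subspaceL2_scale (mu := M)); first exact: subspaceL2_span.
    apply: waveletV_cyl; rewrite deg_comp// d1 gd -bsumdeg_diag// -bsumdegS.
    by apply: bsumdeg_le; rewrite -/(bp_len g) gt mulSnr -addnS leq_add2l.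
  + apply: (subspaceL2_scale (mu := M)); first exact: subspaceL2_span.
    apply: waveletV_cyl; rewrite deg_comp// d2 gd -bsumdeg_diag// -bsumdegS.
    by apply: bsumdeg_le; rewrite -/(bp_len g) gt mulSnr -addnS leq_add2l.
- move=> f Vf.
  have [_] : [set f | L2 M f /\ forall h, [set fun x =>
      nchi M (cyl (Defs.comp (bmor (bp_rng g) (bp_edges g)) p.1)) x -
      nchi M (cyl (Defs.comp (bmor (bp_rng g) (bp_edges g)) p.2)) x] h ->
      dotL2 M h f = 0] f.
    apply: spanL2_min Vf; first by apply: subspaceL2_orth => _ ->.
    move=> _ [l ln ->].
    have hl := L2_indic M (measurable_cyl l); split=> // _ ->.
    rewrite dotL2C//; apply/eqP; rewrite conjc_eq0; apply/eqP.
    apply: dotL2_indic_nchiB;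
      try exact: measurable_cyl; try exact: fine_cyl_neq0.
    set b := bmor _ _ in gs gd c1 c2 *.
    have lb : md_le (deg l) (deg b).
      rewrite gd ln -/(diag_deg k n) -bsumdeg_diag//; apply: bsumdeg_le.
      by rewrite -/(bp_len g) gt leq_addr.
    have [lb0|/set0P[y [ly yb]]] := eqVneq (cyl l `&` cyl b) set0.
      right; split; apply/seteqP; split=> // y [ly yb].
        by rewrite -lb0; split=> //; apply: cyl_comp_sub yb.
      by rewrite -lb0; split=> //; apply: cyl_comp_sub yb.
    have sub := cyl_nested ly yb lb.
    by left; split; apply: subset_trans sub; exact: cyl_comp_sub.
  move=> /(_ _ erefl) h0; rewrite dotL2C//; first by rewrite h0 conjc0.
  exact: waveletV_L2 Vf.
Qed.

Lemma indic_bcyl_mem n j v p : (j <= k)%N -> is_bpath 0 v p ->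
  size p = (n * k + j)%N ->
  spanL2 M (waveletV M n `|` eigen_level n) (chi (bcyl_inf v p)).
Proof.
have gL2 : waveletV M n `|` eigen_level n `<=` L2 M.
  by move=> f [/waveletV_L2|/eigen_level_L2].
elim: j p => [|j IH] p jk vp ps.
  apply: spanL2_gen => //; left; rewrite bcyl_infE//; apply: waveletV_cyl.
  have [_ -> _] := bmor_props vp.
  by rewrite ps addn0 bsumdeg_diag//; exact: md_le_refl.
case/lastP: p vp ps => [|p e]; first by rewrite addnS.
rewrite size_rcons addnS => vpe [ps].
move: (vpe); rewrite is_bpath_rcons add0n => /and3P[vp /eqP re /eqP de].
have [bs _ bE] := bmor_props vp.
rewrite bcyl_infE// bmor_rcons.
have ext e' : e' \in exts (src (bmor v p)) (bdegree k (size p)) ->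
    [/\ rng e' = last v (map src p), deg e' = bdegree k (size p) &
        is_bpath 0 v (rcons p e')].
  rewrite mem_exts// bs => /andP[re' de'].
  by rewrite is_bpath_rcons vp re' de' (eqP re') (eqP de').
apply: (@indic_partition_mem _ T R M _ _
  (exts (src (bmor v p)) (bdegree k (size p)))
  (cyl (bmor v p)) (fun e' => cyl (Defs.comp (bmor v p) e'))).
- exact: subspaceL2_span.
- exact: measurable_cyl.
- by move=> e'; exact: measurable_cyl.
- by move=> e' _; exact: fine_cyl_neq0.
- exact: fine_cyl_neq0.
- exact: (indic_cyl_exts Lfin R[i]).
- by rewrite -bE; apply: IH => //; exact: ltnW.
- move=> i i' /ext[ri di vi] /ext[ri' di' vi'] ii'.
  apply: spanL2_gen => //; right; exists (BPath vp); first by exists j.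
  have gp : ext1 (BPath vp) (i, i') by split.
  apply: spanL2_gen; first by move=> _ [q gq ->]; exact: eigen_path_gen_L2.
  by exists (i, i') => //=; rewrite !bcyl_infE// !bmor_rcons.
- by rewrite mem_exts// bs re de !eqxx.
Qed.

Lemma waveletVS_sub n :
  waveletV M n.+1 `<=` spanL2 M (waveletV M n `|` eigen_level n).
Proof.
apply: spanL2_min; first exact: subspaceL2_span.
move=> _ [l ln ->].
have lb : deg l = bsumdeg k (n * k + k) by rewrite addnC -mulSn bsumdeg_diag.
have [p [vp ps <-]] := bmor_surj lb.
by rewrite -bcyl_infE//; exact: indic_bcyl_mem ps.
Qed.

Lemma waveletW_eigen n : waveletW M n = spanL2 M (eigen_level n).
Proof.
apply/seteqP; split; last exact: eigen_level_sub.
move=> h hW; have [_ _ _ Eae] := subspaceL2_span M (eigen_level n).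
have /waveletVS_sub := hW.1.
rewrite spanL2U; [|exact: waveletV_L2|exact: eigen_level_L2].
move=> [f [g [Vf Eg hE]]].
have {}Vf : waveletV M n f.
  by apply: spanL2_min Vf => //; exact: subspaceL2_span.
have [[fL hL] gL] := (waveletV_L2 Vf, waveletW_L2 hW, Eg.1).
have [_ fW] : waveletW M n f.
  have -> : f = (fun y => h y - g y).
    by rewrite hE; apply/funext => y; rewrite addrK.
  apply: (subspaceL2_sub (mu := M)) => //; first exact: subspaceL2_waveletW.
  exact: eigen_level_sub.
apply: (Eae g) => //; apply: filterS (dotL2_eq0 fL (fW _ Vf)) => y f0.
by rewrite hE f0 add0r.
Qed.

Lemma waveletV_orth_waveletW m n : (m <= n)%N ->
  orthogonalL2 M (waveletV M m) (waveletW M n).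
Proof. by move=> mn f g /(waveletV_le mn) Vf [_]; exact. Qed.

Lemma waveletW_orth m n : m != n ->
  orthogonalL2 M (waveletW M m) (waveletW M n).
Proof.
rewrite neq_ltn => /orP[] mn f g Wf Wg.
  exact: waveletV_orth_waveletW mn _ _ Wf.1 Wg.
have [fL gL] := (waveletW_L2 Wf, waveletW_L2 Wg).
by rewrite dotL2C// (waveletV_orth_waveletW mn Wg.1 Wf) conjc0.
Qed.

Lemma waveletV_sub n :
  waveletV M n `<=` spanL2 M (waveletV M 0 `|` \bigcup_n waveletW M n).
Proof.
have gL2 : waveletV M 0 `|` \bigcup_n waveletW M n `<=` L2 M.
  by move=> f [/waveletV_L2//|[m _ /waveletW_L2]].
elim: n => [|n IH]; first by move=> f Vf; apply: spanL2_gen => //; left.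
apply: subset_trans (@waveletVS_sub n) _.
apply: spanL2_min; first exact: subspaceL2_span.
move=> f [/IH//|En]; apply: spanL2_gen => //; right; exists n => //.
by rewrite waveletW_eigen; apply: spanL2_gen En; exact: eigen_level_L2.
Qed.

Lemma wavelet_hilbert_sum : is_hilbert_sum M (waveletV M 0) (waveletW M).
Proof.
split.
- by move=> n; exact: waveletV_orth_waveletW.
- exact: waveletW_orth.
- exact: waveletV_L2.
- exact: waveletW_L2.
move=> f fL e e0; set V := spanL2 M _.
have sV : subspaceL2 M V by exact: subspaceL2_span.
have Vcyl l n : deg l = diag_deg k n -> V (chi (cyl l)).
  move=> ln; apply: (waveletV_sub (n := n)); apply: waveletV_cyl.
  by rewrite ln; exact: md_le_refl.
have [] : closureL2 M V f.
  apply: (@closureL2_pi _ T R M (@diag_cyl k L) V f) => //.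
  - exact: diag_cyl_setI.
  - exact: borel_diag_cyl.
  - rewrite (indic_setT_mors Lfin R[i] (diag_deg k 0)).
    under eq_fun do rewrite big_seq.
    apply: (subspaceL2_sum (mu := M)) => // l; rewrite mem_mors// => /eqP.
    exact: Vcyl.
  - move=> A [->|[l [n [ln ->]]]]; last exact: Vcyl ln.
    by rewrite indic0; case: sV.
move=> _ /(_ (e ^+ 2) (exprn_gt0 _ e0))[g Vg fg]; exists g; split=> //.
rewrite /normL2 -/(sqnormL2 M _) -[ltRHS]ger0_norm ?ltW// -sqrtr_sqr.
by rewrite ltr_sqrt// exprn_gt0.
Qed.

Lemma bcyl_inf_nil v : bcyl_inf v [::] = cyl (idm v).
Proof. exact: bcyl_infE. Qed.

Lemma waveletV0_orthogonal_sum :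
  is_orthogonal_sum M (waveletV M 0) (eigen_m1 M) (eigen_0 M).
Proof.
have MT_neq0 : fine (M setT) != 0 by rewrite probability_setT oner_eq0.
have L2T : [set chi setT] `<=` L2 M by move=> _ ->; exact: L2_indic.
have mv v : measurable (bcyl_inf v [::] : set T).
  by rewrite bcyl_inf_nil; exact: measurable_cyl.
have L20 : [set f | exists v v' : obj L, v <> v' /\ f = (fun y =>
    nchi M (bcyl_inf v [::]) y - nchi M (bcyl_inf v' [::]) y)] `<=` L2 M.
  by move=> _ [v [v' [_ ->]]]; apply: L2B; exact: L2_nchi.
split.
  apply: orthogonal_spanL2 => // _ _ -> [v [v' [_ ->]]].
  apply: dotL2_indic_nchiB => //; last by left.
  - by rewrite bcyl_inf_nil; exact: fine_cyl_neq0.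
  - by rewrite bcyl_inf_nil; exact: fine_cyl_neq0.
rewrite -spanL2U//; apply/seteqP; split.
- apply: spanL2_min; first exact: subspaceL2_span.
  move=> _ [l l0 ->].
  have lm : l \in mors L (diag_deg k 0) by rewrite mem_mors// l0.
  apply: (@indic_partition_mem _ T R M _ _ (mors L (diag_deg k 0)) setT
    (fun l => cyl l)) lm => //.
  + exact: subspaceL2_span.
  + exact: measurable_cyl.
  + by move=> i _; exact: fine_cyl_neq0.
  + exact: (indic_setT_mors Lfin R[i] (diag_deg k 0)).
  + by apply: spanL2_gen; [rewrite subUset|left].
  + move=> i j; rewrite !mem_mors// => /eqP/deg0_idm iE /eqP/deg0_idm jE ij.
    apply: spanL2_gen; first by rewrite subUset.
    right; exists (rng i), (rng j); split.
      by move=> e; apply: ij; rewrite iE jE e.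
    by rewrite !bcyl_inf_nil -iE -jE.
- apply: spanL2_min; first exact: subspaceL2_span.
  have V0v v : waveletV M 0 (chi (bcyl_inf v [::])).
    by rewrite bcyl_inf_nil; apply: waveletV_cyl; rewrite deg_id; exact: md_le0.
  move=> _ [->|[v [v' [_ ->]]]].
    rewrite (indic_setT_mors Lfin R[i] (diag_deg k 0)).
    under eq_fun do rewrite big_seq.
    apply: (subspaceL2_sum (mu := M)) => [|l]; first exact: subspaceL2_span.
    rewrite mem_mors// => /eqP l0; apply: waveletV_cyl.
    by rewrite l0; exact: md_le_refl.
  apply: (subspaceL2_sub (mu := M)); first exact: subspaceL2_span.
    by apply: (subspaceL2_scale (mu := M)); first exact: subspaceL2_span.
  by apply: (subspaceL2_scale (mu := M)); first exact: subspaceL2_span.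
Qed.

End Decomposition.

Unset Implicit Arguments.

Theorem theorem4p6 (R : realType) (k : nat) (L : kgraph k)
    (x0 : infpath L) (M : probability (borel_infpath x0) R)
    (x : obj L -> R) (delta : R)
    (hk : (0 < k)%N)
    (Lfin : kg_finite L) (Lsc : strongly_connected L)
    (Airr : irreducible_mx (\prod_(i < k) adjacency L R i))
    (hx : is_perron_vector x)
    (hM : is_graph_measure M x)
    (delta01 : 0 < delta < 1)
    (hw : is_weight (w_delta x delta))
    (hdiam : forall g : bpath L,
       (w_delta x delta g)%:E = cyl_diam (w_delta x delta) g) :
  [/\ is_hilbert_sum M (waveletV M 0) (waveletW M),
      is_orthogonal_sum M (waveletV M 0) (eigen_m1 M) (eigen_0 M) &
      forall n : nat,
        waveletW M n =
        spanL2 M (\bigcup_(g in [set g : bpath L | exists2 t : nat,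
                     (t < k)%N & bp_len g = (n * k + t)%N]) eigen_path M g)].
Proof.
have [x_gt0 _ _] := hx; split.
- exact: (wavelet_hilbert_sum hk Lfin x_gt0 hM).
- exact: (waveletV0_orthogonal_sum Lfin x_gt0 hM).
- exact: (waveletW_eigen hk Lfin x_gt0 hM).
Qed.
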